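(* Let $K$ be a field, let $m\le n$ be positive integers, let $1\le t\le m$, and let $X=(X_{ij})$ be the $m\times n$ matrix of variables of the polynomial ring $K[X_{m\times n}]=K[X_{ij}: 1\le i\le m,\ 1\le j\le n]$. Let $\mathcal{M}_t$ be the set of $t$-minors of $X$ and let $A_t(m,n)=K[\mathcal{M}_t]$ be the $K$-subalgebra of $K[X_{m\times n}]$ generated by $\mathcal{M}_t$. There exists a monomial order on $K[X_{m\times n}]$ for which $\mathcal{M}_t$ is a Sagbi basis of $A_t(m,n)$ if and only if at least one of the following holds: (1) $m=t$ (and $n\ge t$); (2) $m=n=t+1$; (3) $t=1$.
   Context: The $t$-minors of $X$ are the determinants of its $t\times t$ submatrices. Given a polynomial ring $R$ over $K$ with a monomial order and a $K$-subalgebra $A\subset R$, the initial algebra $\operatorname{in}(A)$ is the $K$-subalgebra of $R$ which, as a $K$-vector space, is spanned by the initial (leading) monomials of the nonzero elements of $A$. A subset $\mathcal{F}\subset A$ is a Sagbi basis of $A$ (with respect to the given order) if the initial monomials $\operatorname{in}(f)$, $f\in\mathcal{F}$, generate $\operatorname{in}(A)$ as a $K$-algebra. *)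

(* Defs.v *)
From mathcomp Require Import all_boot all_order all_algebra.
From mathcomp Require Export mpoly.

Set Implicit Arguments.
Unset Strict Implicit.
Unset Printing Implicit Defensive.

Import GRing.Theory.

Local Open Scope ring_scope.

Section Generation.
Variables (K : fieldType) (A : algType K).
Implicit Types (S B : A -> Prop) (p : A).

Definition subalgebra B : Prop :=
  [/\ B 1,
      forall (a : K) u v, B u -> B v -> B (a *: u + v)
    & forall u v, B u -> B v -> B (u * v)].

Definition generated_subalgebra S p : Prop :=
  forall B, subalgebra B -> (forall f, S f -> B f) -> B p.

Definition linear_span S p : Prop :=
  exists r : seq (K * A),
    (forall c, c \in r -> S c.2) /\ p = \sum_(c <- r) c.1 *: c.2.

End Generation.

(* In 'X_{1..N} the monomials are written additively: 0%MM is the monomial 1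
   and (u + v)%MM is the product of u and v. *)
Definition monomial_order N (le : rel 'X_{1..N}) : Prop :=
  [/\ total le, antisymmetric le, transitive le,
      forall u, le 0%MM u
    & forall u v w, le u v -> le (u + w)%MM (v + w)%MM].

Section Sagbi.
Variables (K : fieldType) (N : nat) (le : rel 'X_{1..N}).
Implicit Types (A F : {mpoly K[N]} -> Prop) (p f : {mpoly K[N]}).

(* 0 has empty support, hence no initial monomial. *)
Definition is_initial_monomial f (u : 'X_{1..N}) : Prop :=
  u \in msupp f /\ (forall v, v \in msupp f -> le v u).

Definition initial_monomials F p : Prop :=
  exists f u, [/\ F f, is_initial_monomial f u & p = 'X_[u]].

Definition initial_algebra A : {mpoly K[N]} -> Prop :=
  linear_span (initial_monomials A).

Definition sagbi_basis F A : Prop :=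
  (forall f, F f -> A f) /\
  (forall p, generated_subalgebra (initial_monomials F) p <->
             initial_algebra A p).

End Sagbi.

Section Minors.
Variables (K : fieldType) (m n : nat).

(* The variable X_ij is the one of index mxvec_index i j, where mxvec_index
   is a bijection from 'I_m * 'I_n to 'I_(m * n). *)
Definition generic_matrix : 'M[{mpoly K[m * n]}]_(m, n) :=
  \matrix_(i < m, j < n) 'X_(mxvec_index i j).

Definition increasing t k (f : 'I_t -> 'I_k) : Prop :=
  forall i j : 'I_t, (i < j)%N -> (f i < f j)%N.

Definition minors (t : nat) (p : {mpoly K[m * n]}) : Prop :=
  exists (f : 'I_t -> 'I_m) (g : 'I_t -> 'I_n),
    [/\ increasing f, increasing g & p = \det (mxsub f g generic_matrix)].

Definition minors_algebra (t : nat) : {mpoly K[m * n]} -> Prop :=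
  generated_subalgebra (minors t).

End Minors.

(* Main.v *)
Require Import Defs.
From mathcomp Require Import all_boot all_order all_fingroup all_algebra.
From mathcomp Require Import zify.

(* If the t-minors are a Sagbi basis and 1 < t < m, (m, n) <> (t+1, t+1), there
   are t+1 rows R and t+2 columns D of X. For a column set C of size t+1, a
   product of the (t+1)-minor on R x C and a complementary (t-1)-minor is a
   2 x 2 determinant of t-minors (Jacobi), so its initial monomial is a product
   of two initial monomials of t-minors. By degree reasons, the initial matching
   of the t-minor on (R - i) x (C - j) then contains every edge of the initial
   matching of R x C that avoids i and j. Comparing C = D - c and C = D - c'
   through their common t-minors shows that their initial matchings differ only
   at the row matched to c', which is impossible for three different columns.

   Conversely, if m = n = t + 1, the lexicographic order with the diagonal
   variables first makes the initial monomials of the t-minors algebraically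
   independent.

   If m = t, take the lexicographic order by columns. An element f of the algebra
   is invariant under adding row i' to row i and all its monomials have equal row
   degrees. A degree argument on rows i < i' restricted to the columns after c
   shows that the initial monomial u of f satisfies
   sum_(b >= c) u_(i,b) <= sum_(b > c) u_(i',b), and these inequalities say that
   u is a product of main diagonals. *)

Set Implicit Arguments.
Unset Strict Implicit.
Unset Printing Implicit Defensive.

Import GRing.Theory.
Local Open Scope ring_scope.

(** * Initial monomials and Sagbi bases *)

(** Exponents are additive, so a monomial lies in the algebra generated by a set of monomials
    exactly when its exponent lies in this monoid. *)
Definition monoid_gen N (S : 'X_{1..N} -> Prop) (u : 'X_{1..N}) : Prop :=
  exists2 s : seq 'X_{1..N},
    (forall v, v \in s -> S v) & u = (\sum_(v <- s) v)%MM.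

Lemma monoid_gen0 N (S : 'X_{1..N} -> Prop) : monoid_gen S 0%MM.
Proof. by exists [::] => //; rewrite big_nil. Qed.

Lemma monoid_gen1 N (S : 'X_{1..N} -> Prop) u : S u -> monoid_gen S u.
Proof. by move=> Su; exists [:: u] => [v /[1!inE] /eqP->|] //; rewrite big_seq1. Qed.

Lemma monoid_genD N (S : 'X_{1..N} -> Prop) u v :
  monoid_gen S u -> monoid_gen S v -> monoid_gen S (u + v)%MM.
Proof.
move=> [s Ss ->] [r Sr ->]; exists (s ++ r); last by rewrite big_cat.
by move=> w; rewrite mem_cat => /orP[/Ss | /Sr].
Qed.

Section Generated.
Variables (K : fieldType) (A : algType K).
Implicit Types (S B : A -> Prop).

Lemma generated_subalgebraP S : subalgebra (generated_subalgebra S).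
Proof.
split=> [B [] //|a u v Su Sv B SB BS|u v Su Sv B SB BS].
  by case: (SB) => _ BD _; apply: BD; [apply: Su | apply: Sv].
by case: (SB) => _ _ BM; apply: BM; [apply: Su | apply: Sv].
Qed.

Lemma generated_subalgebra_gen S p : S p -> generated_subalgebra S p.
Proof. by move=> Sp B _; apply. Qed.

Lemma subalgebra0 B : subalgebra B -> B 0.
Proof. by case=> B1 BD _; rewrite -(addNr 1) -scaleN1r; apply: BD. Qed.

Lemma subalgebraZ B c p : subalgebra B -> B p -> B (c *: p).
Proof.
by move=> sB Bp; rewrite -[_ *: _]addr0; case: (sB) => _ BD _;
  apply: BD => //; apply: subalgebra0.
Qed.

Lemma subalgebra_sum B I (r : seq I) (P : pred I) (F : I -> A) :
  subalgebra B -> (forall i, P i -> B (F i)) -> B (\sum_(i <- r | P i) F i).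
Proof.
move=> sB BF; apply: big_ind => //; first exact: subalgebra0.
by move=> x y Bx By; case: (sB) => _ BD _; rewrite -[x]scale1r; apply: BD.
Qed.

End Generated.

Section InitialMonomial.
Variables (K : fieldType) (N : nat) (le : rel 'X_{1..N}).
Hypothesis le_mo : monomial_order le.
Implicit Types (p q f : {mpoly K[N]}) (u v : 'X_{1..N}).
Implicit Types (A F : {mpoly K[N]} -> Prop).

Lemma mo_refl u : le u u.
Proof. by case: le_mo => /(_ u u); rewrite orbb. Qed.

Lemma mo_addl u v w : le u v -> le (w + u)%MM (w + v)%MM.
Proof. by case: le_mo => _ _ _ _ leD /leD; rewrite ![(w + _)%MM]addmC; apply. Qed.

Lemma mo_add a b u v : le a u -> le b v -> le (a + b)%MM (u + v)%MM.
Proof.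
move=> au bv; case: le_mo => _ _ tr _ leD; apply: tr (leD _ _ b au) _.
exact: mo_addl.
Qed.

(** The exponent [u + b] lies between [a + b] and [u + v]. These are equal, so antisymmetry and
    cancellation of [b] give [a = u]. *)
Lemma mo_add_inj a b u v :
  le a u -> le b v -> (a + b)%MM = (u + v)%MM -> a = u /\ b = v.
Proof.
move=> au bv e; case: le_mo => _ asym _ _ leD.
suff au_eq : a = u by split=> //; move: e; rewrite au_eq => /addmI.
apply: (@addIm _ b); apply: asym; rewrite leD //= e; exact: mo_addl.
Qed.

(** By [mo_add_inj], only the pair [(u, v)] of exponents contributes to the coefficient at
    [u + v]. *)
Lemma mcoeffM_top p q u v :
    (forall a, a \in msupp p -> le a u) -> (forall b, b \in msupp q -> le b v) ->
  (p * q)@_(u + v) = p@_u * q@_v.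
Proof.
move=> pu qv; rewrite mpolyME raddf_sum big_allpairs /=.
have cE a b : a \in msupp p -> b \in msupp q ->
    (p@_a * q@_b *: 'X_[a + b])@_(u + v) =
    p@_a * q@_b * ((a == u) && (b == v))%:R.
  move=> ap bq; rewrite mcoeffZ mcoeffX; congr (_ * _%:R).
  congr nat_of_bool; apply/eqP/andP => [|[/eqP-> /eqP->] //].
  by move=> /(mo_add_inj (pu _ ap) (qv _ bq)) [-> ->].
have [up|up] := boolP (u \in msupp p); last first.
  rewrite (memN_msupp_eq0 up) mul0r big_seq big1 // => a ap.
  rewrite big_seq big1 // => b bq; rewrite cE //.
  by have [e|_] := eqVneq a u; [rewrite e (negbTE up) in ap | rewrite mulr0].
rewrite (bigD1_seq u) ?msupp_uniq //= [X in _ + X]big_seq_cond [X in _ + X]big1 ?addr0; last first.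
  move=> a /andP[ap /negbTE au]; rewrite big_seq big1 // => b bq.
  by rewrite cE // au mulr0.
have [vq|vq] := boolP (v \in msupp q); last first.
  rewrite (memN_msupp_eq0 vq) mulr0 big_seq big1 // => b bq; rewrite cE //.
  by have [e|_] := eqVneq b v; [rewrite e (negbTE vq) in bq | rewrite andbF mulr0].
rewrite (bigD1_seq v) ?msupp_uniq //= cE // !eqxx mulr1.
rewrite big_seq_cond big1 ?addr0 // => b /andP[bq /negbTE bv].
by rewrite cE // bv andbF mulr0.
Qed.

Lemma initial_monomialM p q u v :
  is_initial_monomial le p u -> is_initial_monomial le q v ->
  is_initial_monomial le (p * q) (u + v)%MM.
Proof.
move=> [up pu] [vq qv]; split.
  by move: up vq; rewrite !mcoeff_msupp mcoeffM_top // => ? ?; rewrite mulf_neq0.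
move=> w /msuppM_le /allpairsP[[a b] /= [ap bq ->]].
by apply: mo_add; [apply: pu | apply: qv].
Qed.

Lemma initial_monomialX u : is_initial_monomial le ('X_[u] : {mpoly K[N]}) u.
Proof.
by split=> [|v]; rewrite msuppX inE // => /eqP->; apply: mo_refl.
Qed.

Lemma initial_monomial1 : is_initial_monomial le (1 : {mpoly K[N]}) 0%MM.
Proof. by rewrite -mpolyX0; apply: initial_monomialX. Qed.

Lemma initial_monomial_prod (I : eqType) (r : seq I) (G : I -> {mpoly K[N]})
    (e : I -> 'X_{1..N}) (c : I -> nat) :
    (forall i, i \in r -> is_initial_monomial le (G i) (e i)) ->
  is_initial_monomial le (\prod_(i <- r) G i ^+ c i) (\sum_(i <- r) e i *+ c i)%MM.
Proof.
elim: r => [|i r IHr] Ge; first by rewrite !big_nil; apply: initial_monomial1.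
rewrite !big_cons; apply: initial_monomialM; last first.
  by apply: IHr => j jr; apply: Ge; rewrite inE jr orbT.
elim: (c i) => [|k IHk]; first by rewrite expr0 mulm0n; apply: initial_monomial1.
by rewrite exprS mulmS; apply: initial_monomialM => //; apply: Ge; rewrite inE eqxx.
Qed.

Lemma initial_monomial_inj p u v :
  is_initial_monomial le p u -> is_initial_monomial le p v -> u = v.
Proof.
move=> [up pu] [vp pv]; case: le_mo => _ asym _ _ _; apply: asym.
by rewrite pv //= pu.
Qed.

(** With [e = id] this yields initial monomials; a general key [e] compares the initial monomials
    attached to the terms in [independent_initial]. *)
Lemma max_exists (T : eqType) (r : seq T) (e : T -> 'X_{1..N}) :
  r != [::] -> exists2 x, x \in r & forall y, y \in r -> le (e y) (e x).
Proof.
case: le_mo => tot _ tr _ _; elim: r => // x r IHr _.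
have [->|/IHr [y yr ymax]] := eqVneq r [::].
  by exists x => [|y]; rewrite inE // => /eqP ->; apply: mo_refl.
have [yx|xy] := boolP (le (e y) (e x)).
  exists x => [|z]; rewrite inE ?eqxx // => /orP[/eqP->|/ymax zy]; first exact: mo_refl.
  exact: tr zy yx.
exists y => [|z]; rewrite inE ?yr ?orbT // => /orP[/eqP->|/ymax //].
by have := tot (e x) (e y); rewrite (negbTE xy) orbF.
Qed.

Lemma initial_monomial_exists p : p != 0 -> exists u, is_initial_monomial le p u.
Proof.
by rewrite -msupp_eq0 => /(max_exists id) [u up umax]; exists u.
Qed.

Definition initial_exponents F u : Prop :=
  exists2 f, F f & is_initial_monomial le f u.

(** The polynomials whose exponents all lie in the monoid form a subalgebra that contains the
    generators. *)
Lemma generated_initial_supp F p u :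
  generated_subalgebra (initial_monomials le F) p -> u \in msupp p ->
  monoid_gen (initial_exponents F) u.
Proof.
move=> Gp; move: p Gp u.
suff sB : subalgebra
    (fun p => forall u, u \in msupp p -> monoid_gen (initial_exponents F) u).
  move=> p /(_ _ sB); apply => _ [f [v [Ff fv ->]]] u; rewrite msuppX inE => /eqP->.
  by apply: monoid_gen1; exists f.
split=> [u|a p q Bp Bq u|p q Bp Bq u].
- by rewrite -mpolyC1 msupp1 inE => /eqP->; apply: monoid_gen0.
- move=> /msuppD_le; rewrite mem_cat => /orP[/msuppZ_le|]; [exact: Bp | exact: Bq].
move=> /msuppM_le /allpairsP[[v w] /= [vp wq ->]].
by apply: monoid_genD; [apply: Bp | apply: Bq].
Qed.

Lemma generated_initialX F u :
  monoid_gen (initial_exponents F) u ->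
  generated_subalgebra (initial_monomials le F) 'X_[u].
Proof.
have [G1 _ GM] := generated_subalgebraP (initial_monomials le F).
move=> [s Ss ->]; elim: s Ss => [|v s IHs] Ss; first by rewrite big_nil mpolyX0.
rewrite big_cons mpolyXD; apply: GM.
  apply: generated_subalgebra_gen; have [f Ff fv] := Ss v (mem_head _ _).
  by exists f, v.
by apply: IHs => w ws; apply: Ss; rewrite inE ws orbT.
Qed.

Lemma initial_algebraP A : subalgebra A -> subalgebra (initial_algebra le A).
Proof.
move=> [A1 AD AM]; split.
- exists [:: (1, 1)]; split; last by rewrite big_seq1 scale1r.
  move=> _ /[1!inE] /eqP->; exists 1, 0%MM.
  by rewrite mpolyX0; split=> //; apply: initial_monomial1.
- move=> a u v [r [Ar ->]] [s [As ->]]; exists ([seq (a * c.1, c.2) | c <- r] ++ s); split.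
    by move=> c; rewrite mem_cat => /orP[/mapP[b /Ar ? ->] | /As].
  rewrite big_cat big_map scaler_sumr; congr (_ + _).
  by apply: eq_bigr => c _; rewrite scalerA.
move=> u v [r [Ar ->]] [s [As ->]].
exists [seq (c.1 * d.1, c.2 * d.2) | c <- r, d <- s]; split.
  move=> _ /allpairsP[[c d] /= [/Ar [f [x [Af fx cE]]] /As [g [y [Ag gy dE]]] ->]] /=.
  exists (f * g), (x + y)%MM; split; [exact: AM | exact: initial_monomialM |].
  by rewrite mpolyXD cE dE.
rewrite big_allpairs_dep /= mulr_suml; apply: eq_bigr => c _.
rewrite mulr_sumr; apply: eq_bigr => d _.
by rewrite -scalerAl -scalerAr scalerA.
Qed.

(** One inclusion is automatic from [F] being contained in [A]. The other can be tested on single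
    initial monomials, since they span the initial algebra. *)
Lemma sagbi_basis_intro F A :
    subalgebra A -> (forall f, F f -> A f) ->
    (forall f u, A f -> is_initial_monomial le f u ->
       monoid_gen (initial_exponents F) u) ->
  sagbi_basis le F A.
Proof.
move=> sA FA inA; split=> // p; split=> [|[r [Ar ->]]].
  apply; first exact: initial_algebraP.
  move=> _ [f [u [Ff fu ->]]]; exists [:: (1, 'X_[u])]; split; last by rewrite big_seq1 scale1r.
  by move=> _ /[1!inE] /eqP->; exists f, u; split=> //; apply: FA.
rewrite big_seq; apply: subalgebra_sum => [|c cr]; first exact: generated_subalgebraP.
apply: (subalgebraZ _ (generated_subalgebraP _)).
by have [f [u [Af fu ->]]] := Ar c cr; apply: generated_initialX; apply: inA fu.
Qed.

Lemma sagbi_basis_elim F A f u :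
  sagbi_basis le F A -> A f -> is_initial_monomial le f u ->
  monoid_gen (initial_exponents F) u.
Proof.
move=> [_ inA] Af fu; apply: (@generated_initial_supp F 'X_[u]); last first.
  by rewrite msuppX inE.
apply/inA; exists [:: (1, 'X_[u])]; split; last by rewrite big_seq1 scale1r.
by move=> _ /[1!inE] /eqP->; exists f, u.
Qed.

End InitialMonomial.

(** * Lexicographic orders for an arbitrary ranking of the variables *)

Section LexOrder.
Variables (N : nat) (pos : 'I_N -> nat).
Hypothesis pos_inj : injective pos.
Implicit Types (u v w : 'X_{1..N}) (k : 'I_N).

(** The variable with the smallest [pos] is the largest one: the differing exponent of smallest
    position decides. *)
Definition lex_le u v :=
  (u == v) ||
  [exists k, (u k < v k)%N && [forall j, (pos j < pos k)%N ==> (u j == v j)]].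

Lemma first_difference u v : u != v ->
  exists2 k, u k != v k & forall j, (pos j < pos k)%N -> u j = v j.
Proof.
move=> uv; have [k0 k0P] : exists k, u k != v k.
  apply/existsP; apply: contraNT uv; rewrite negb_exists => /forallP uv.
  by apply/eqP/mnmP => k; apply/eqP; have := uv k; rewrite negbK.
case: (@arg_minnP _ k0 (fun k => u k != v k) pos k0P) => k kP kmin.
exists k => // j; apply: contraTeq => /kmin; by rewrite -leqNgt.
Qed.

Lemma lex_leP u v :
  reflect (u = v \/ exists2 k, (u k < v k)%N &
             forall j, (pos j < pos k)%N -> u j = v j)
          (lex_le u v).
Proof.
apply: (iffP orP) => [[/eqP|/existsP[k /andP[uvk /forallP h]]]|[->|[k uvk h]]].
- by left.
- by right; exists k => // j jk; apply/eqP; apply: (implyP (h j)).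
- by left.
right; apply/existsP; exists k; rewrite uvk; apply/forallP => j.
by apply/implyP => /h ->.
Qed.

Lemma lex_leN u v k :
  (v k < u k)%N -> (forall j, (pos j < pos k)%N -> u j = v j) -> ~~ lex_le u v.
Proof.
move=> vu h; apply/negP => /lex_leP [e|[l uvl hl]]; first by rewrite e ltnn in vu.
case: (ltngtP (pos k) (pos l)) => [/hl e|/h e|/pos_inj e].
- by rewrite e ltnn in vu.
- by rewrite e ltnn in uvl.
by rewrite -e in uvl; have := ltn_trans vu uvl; rewrite ltnn.
Qed.

Lemma lex_le_mo : monomial_order lex_le.
Proof.
have key u v k : (u k < v k)%N -> (forall j, (pos j < pos k)%N -> u j = v j) -> lex_le u v.
  by move=> uv h; apply/lex_leP; right; exists k.
split.
- move=> u v; have [->|/first_difference [k]] := eqVneq u v.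
    by apply/orP; left; apply/lex_leP; left.
  rewrite neq_ltn => /orP[lt h|lt h]; apply/orP; first by left; apply: key lt h.
  by right; apply: key lt _ => j /h ->.
- move=> u v /andP[uv /lex_leP [-> //|[k vuk h]]].
  suff : ~~ lex_le u v by rewrite uv.
  by apply: lex_leN vuk _ => j /h ->.
- move=> v u w /lex_leP[-> //|[k uvk hk]] /lex_leP[<-|[l vwl hl]].
    exact: key uvk hk.
  case: (ltngtP (pos k) (pos l)) => [kl|lk|/pos_inj e].
  + apply: (key u w k) => [|j jk]; first by rewrite -(hl k kl).
    by rewrite hk // hl // (ltn_trans jk kl).
  + apply: (key u w l) => [|j jl]; first by rewrite hk.
    by rewrite hk ?hl // (ltn_trans jl lk).
  by subst l; apply: (key u w k) => [|j jk]; [apply: ltn_trans vwl | rewrite hk ?hl].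
- move=> u; have [->|/first_difference [k nz h]] := eqVneq 0%MM u.
    by apply/lex_leP; left.
  by apply: (key _ _ k) => //; move: nz; rewrite mnm0E eq_sym -lt0n.
move=> u v w /lex_leP[->|[k uvk hk]]; first by apply/lex_leP; left.
by apply: (key _ _ k) => [|j /hk]; rewrite !mnmDE ?ltn_add2r // => ->.
Qed.

End LexOrder.

(** * Monomials of minors *)

Section IncreasingMaps.
Variable k : nat.

Lemma increasing_inj l (f : 'I_k -> 'I_l) : increasing f -> injective f.
Proof.
move=> fi x y fxy; apply: val_inj.
by case: (ltngtP (val x) (val y)) => // /fi; rewrite fxy ltnn.
Qed.

Lemma same_codom_perm (T : finType) (f f' : 'I_k -> T) :
    injective f -> injective f' -> codom f =i codom f' ->
  exists s : 'S_k, f =1 f' \o s.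
Proof.
move=> fi fi' ff'.
have cf i : f i \in codom f' by rewrite -ff' codom_f.
have gi : injective (fun i => iinv (cf i)).
  by move=> i j /(congr1 f'); rewrite !f_iinv => /fi.
by exists (perm gi) => i; rewrite /= permE f_iinv.
Qed.

Lemma increasing_enum l (A : {set 'I_l}) : #|A| = k ->
  exists2 f : 'I_k -> 'I_l, increasing f & codom f =i A.
Proof.
move=> Ak; have sA : sorted ltn (map val (enum A)).
  rewrite -[enum A]filter_predT /enum_mem -enumT.
  rewrite filter_predT; have := iota_ltn_sorted 0 l; rewrite -val_enum_ord => sE.
  exact: (subseq_sorted ltn_trans (map_subseq _ (filter_subseq _ _)) sE).
have szA : size (enum A) = k by rewrite -cardE.
have lk (i : 'I_k) : (i < size (enum A))%N by rewrite szA.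
exists (fun i => tnth (in_tuple (enum A)) (cast_ord (esym szA) i)) => [i j ij|x].
  have x0 := tnth (in_tuple (enum A)) (cast_ord (esym szA) i).
  rewrite !(tnth_nth x0) /= -!(nth_map x0 0%N val) //.
  by rewrite (sorted_ltn_nth ltn_trans) ?inE ?size_map.
apply/codomP/idP => [[i ->]|]; first by rewrite -mem_enum mem_tnth.
rewrite -mem_enum => /(tnthP (in_tuple _)) [i ->].
by exists (cast_ord szA i); rewrite cast_ordK.
Qed.

Lemma inj_card_codom l (f : 'I_k -> 'I_l) (A : {set 'I_l}) :
  injective f -> codom f =i A -> #|A| = k.
Proof. by move=> fi fA; rewrite -(eq_card fA) card_codom // card_ord. Qed.

End IncreasingMaps.

Section MinorMonomials.
Variables (K : fieldType) (m n : nat).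
Local Notation ix := (@mxvec_index m n).
Local Notation X := (generic_matrix K m n).
Implicit Types (u v : 'X_{1..m * n}).

Lemma mxvec_index_eq i j i' j' : (ix i j == ix i' j') = (i == i') && (j == j').
Proof.
by rewrite /mxvec_index (inj_eq (@cast_ord_inj _ _ _)) (inj_eq enum_rank_inj).
Qed.

Lemma mnm_matrixP (u v : 'X_{1..m * n}) :
  (forall i j, u (ix i j) = v (ix i j)) <-> u = v.
Proof.
split=> [uv|-> //]; apply/mnmP => k.
by case/mxvec_indexP: k => i j; apply: uv.
Qed.

Definition row_sum (u : 'X_{1..m * n}) r := (\sum_j u (ix r j))%N.
Definition col_sum (u : 'X_{1..m * n}) c := (\sum_i u (ix i c))%N.

Lemma row_sumD u v r : row_sum (u + v)%MM r = (row_sum u r + row_sum v r)%N.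
Proof. by rewrite /row_sum -big_split; apply: eq_bigr => j _; rewrite mnmDE. Qed.

Lemma col_sumD u v c : col_sum (u + v)%MM c = (col_sum u c + col_sum v c)%N.
Proof. by rewrite /col_sum -big_split; apply: eq_bigr => j _; rewrite mnmDE. Qed.

Lemma row_sum0 r : row_sum 0%MM r = 0%N.
Proof. by rewrite /row_sum big1 // => j _; rewrite mnm0E. Qed.

Lemma leq_row_sum u i j : (u (ix i j) <= row_sum u i)%N.
Proof. by rewrite /row_sum (bigD1 j) //= leq_addr. Qed.

Lemma leq_col_sum u i j : (u (ix i j) <= col_sum u j)%N.
Proof. by rewrite /col_sum (bigD1 i) //= leq_addr. Qed.

Lemma mdeg_row_sum u : mdeg u = (\sum_i row_sum u i)%N.
Proof.
rewrite mdegE pair_big (reindex (uncurry ix)) /=; last exact: curry_mxvec_bij.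
by apply: eq_bigr => [[i j]].
Qed.

Section FixedSize.
Variable k : nat.
Implicit Types (f : 'I_k -> 'I_m) (g : 'I_k -> 'I_n).

Definition minor f g := \det (mxsub f g X).

(** A term of the determinant is seen as a perfect matching joining the row [f i] to the column
    [g (s i)]. *)
Definition matching_mnm f g (s : 'S_k) : 'X_{1..m * n} :=
  (\sum_i U_(ix (f i) (g (s i))))%MM.

Lemma minorE f g : minor f g = \sum_(s : 'S_k) (-1) ^+ s *: 'X_[matching_mnm f g s].
Proof.
apply: eq_bigr => s _; rewrite -mul_mpolyC rmorphXn /= mpolyCN mpolyC1.
congr (_ * _); rewrite /matching_mnm -mprodXE /=.
by apply: eq_bigr => i _; rewrite !mxE.
Qed.

Lemma msupp_minorP f g v : v \in msupp (minor f g) -> exists s, v = matching_mnm f g s.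
Proof.
rewrite minorE => /msupp_sum_le /flattenP [_ /mapP[s _ ->]].
by move=> /msuppZ_le; rewrite msuppX inE => /eqP; exists s.
Qed.

Lemma matching_mnmE f g s i j : injective f ->
  matching_mnm f g s (ix (f i) j) = (g (s i) == j).
Proof.
move=> fi; rewrite mnm_sumE (bigD1 i) //= mnm1E mxvec_index_eq eqxx /=.
rewrite big1 ?addn0 // => l li; rewrite mnm1E mxvec_index_eq (inj_eq fi).
by rewrite (negbTE li).
Qed.

Lemma matching_mnm_inj f g : injective f -> injective g -> injective (matching_mnm f g).
Proof.
move=> fi gi s s' e; apply/permP => i; apply: gi; apply/eqP.
by move/mnm_matrixP/(_ (f i) (g (s' i))): e; rewrite !matching_mnmE // eqxx; case: eqP.
Qed.

(** Distinct permutations give distinct monomials, so no term of a minor cancels, whatever the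
    characteristic. *)
Lemma matching_mnm_supp f g s :
  injective f -> injective g -> matching_mnm f g s \in msupp (minor f g).
Proof.
move=> fi gi; rewrite mcoeff_msupp minorE raddf_sum (bigD1 s) //= big1 ?addr0.
  by rewrite mcoeffZ mcoeffX eqxx mulr1 signr_eq0.
move=> s' ss'; rewrite mcoeffZ mcoeffX (inj_eq (matching_mnm_inj fi gi)).
by rewrite (negbTE ss') mulr0.
Qed.

Lemma minor_neq0 f g : injective f -> injective g -> minor f g != 0.
Proof.
move=> fi gi; rewrite -msupp_eq0; apply/negP => /eqP e.
by have := matching_mnm_supp 1%g fi gi; rewrite e.
Qed.

Lemma row_sum_minor f g v r : injective f ->
  v \in msupp (minor f g) -> row_sum v r = (r \in codom f).
Proof.
move=> fi /msupp_minorP [s ->]; have [/codomP[i ->]|rf] := boolP (r \in codom f).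
  rewrite /row_sum (bigD1 (g (s i))) //= matching_mnmE // eqxx.
  by rewrite big1 // => j; rewrite matching_mnmE // eq_sym => /negbTE->.
rewrite /row_sum big1 // => j _; rewrite mnm_sumE big1 // => i _.
rewrite mnm1E mxvec_index_eq; case: eqP => //= e.
by rewrite -e codom_f in rf.
Qed.

Lemma col_sum_minor f g v c : injective g ->
  v \in msupp (minor f g) -> col_sum v c = (c \in codom g).
Proof.
move=> gi /msupp_minorP [s ->].
transitivity (\sum_(i < k) (g (s i) == c))%N.
  rewrite /col_sum; under eq_bigr do rewrite mnm_sumE.
  rewrite exchange_big; apply: eq_bigr => i _ /=.
  rewrite (bigD1 (f i)) //= mnm1E mxvec_index_eq eqxx big1 ?addn0 // => r rf.
  by rewrite mnm1E mxvec_index_eq eq_sym (negbTE rf).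
have [/codomP[i ->]|cg] := boolP (c \in codom g).
  rewrite (bigD1 ((s^-1)%g i)) //= permKV eqxx big1 // => l li.
  rewrite (inj_eq gi); case: eqP => // e.
  by rewrite -e permK eqxx in li.
by rewrite big1 // => i _; case: eqP => // e; rewrite -e codom_f in cg.
Qed.

Lemma minor_perm f f' g g' (s s' : 'S_k) : f =1 f' \o s -> g =1 g' \o s' ->
  minor f g = (-1) ^+ (s (+) s') *: minor f' g'.
Proof.
move=> ff' gg'; have -> : minor f g = \det (row_perm s (col_perm s' (mxsub f' g' X))).
  by congr (\det _); apply/matrixP => i j; rewrite !mxE ff' gg'.
rewrite row_permE col_permE !det_mulmx !det_perm odd_permV signr_addb.
have sg (b : bool) (p : {mpoly K[m * n]}) : (-1) ^+ b * p = (-1) ^+ b *: p.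
  by case: b; rewrite ?expr0 ?mul1r ?scale1r // !expr1 mulN1r scaleN1r.
by rewrite [X in _ * X]mulrC !sg scalerA.
Qed.

(** Reordering rows and columns only changes the sign. Hence arbitrary injections can replace
    increasing maps, and the initial monomial depends only on the sets of rows and columns. *)
Lemma minor_same_codom f f' g g' : injective f -> injective f' ->
    injective g -> injective g' ->
    codom f =i codom f' -> codom g =i codom g' ->
  exists b : bool, minor f g = (-1) ^+ b *: minor f' g'.
Proof.
move=> fi fi' gi gi' ff' gg'.
have [s sE] := same_codom_perm fi fi' ff'; have [s' s'E] := same_codom_perm gi gi' gg'.
by exists (s (+) s'); apply: minor_perm.
Qed.

Lemma initial_sign (le : rel 'X_{1..m * n}) (b : bool) (p : {mpoly K[m * n]}) u :
  is_initial_monomial le ((-1) ^+ b *: p) u <-> is_initial_monomial le p u.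
Proof.
have e v : (v \in msupp ((-1) ^+ b *: p)) = (v \in msupp p).
  by rewrite !mcoeff_msupp mcoeffZ mulf_eq0 signr_eq0.
split=> -[up umax]; split=> [|v vp].
- by rewrite -e.
- by apply: umax; rewrite e.
- by rewrite e.
by apply: umax; rewrite -e.
Qed.

End FixedSize.

End MinorMonomials.

(** * Products of minors of different sizes *)

(** Jacobi's identity for the complement of a 2 x 2 block. Multiplying [Y] by the first two columns
    of its adjugate, completed by an identity block, gives a block triangular matrix with
    [(\det Y)%:M] of size 2 in the corner; one factor [\det Y] is then cancelled. *)
Lemma det_adj_ulsubmx (R : idomainType) p (Y : 'M[R]_(2 + p)) : \det Y != 0 ->
  \det Y * \det (drsubmx Y) = \det (ulsubmx (\adj Y)).
Proof.
move=> nzY; set a := ulsubmx (\adj Y); set c := dlsubmx (\adj Y).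
have YB : Y *m block_mx a 0 c 1%:M =
          block_mx (\det Y)%:M (ursubmx Y) 0 (drsubmx Y).
  have := mul_mx_adj Y.
  rewrite -{1}[Y]submxK -{1}[\adj Y]submxK scalar_mx_block !mulmx_block.
  move=> /eq_block_mx [e1 _ e2 _].
  by rewrite -{1}[Y]submxK mulmx_block e1 e2 !mulmx0 !mulmx1 !add0r.
have := congr1 determinant YB.
rewrite det_mulmx det_lblock det_ublock det1 mulr1 det_scalar expr2 -mulrA.
by move=> /(mulfI nzY).
Qed.

Lemma subalgebra_det (K : fieldType) (A : comAlgType K) (B : A -> Prop) k (Y : 'M[A]_k) :
  subalgebra B -> (forall i j, B (Y i j)) -> B (\det Y).
Proof.
move=> sB BY; case: (sB) => B1 _ BM; apply: subalgebra_sum => // s _.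
rewrite -signr_odd; apply: (BM); last by apply: big_ind.
by case: odd; rewrite ?expr1 -?scaleN1r //; apply: subalgebraZ.
Qed.

Section InitialMinors.
Variables (K : fieldType) (m n : nat) (le : rel 'X_{1..m * n}).
Hypothesis le_mo : monomial_order le.
Local Notation ix := (@mxvec_index m n).
Implicit Types (I : {set 'I_m}) (J : {set 'I_n}) (u v : 'X_{1..m * n}).

Lemma minors_minor t (f : 'I_t -> 'I_m) (g : 'I_t -> 'I_n) :
  injective f -> injective g -> minors_algebra t (minor K f g).
Proof.
move=> fi gi.
have [f' f'i f'E] :=
  @increasing_enum t m [set x in codom f]
    (inj_card_codom fi (fun x => esym (in_set _ _))).
have [g' g'i g'E] :=
  @increasing_enum t n [set x in codom g]
    (inj_card_codom gi (fun x => esym (in_set _ _))).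
have [] := @minor_same_codom K m n t f f' g g' => //; try exact: increasing_inj.
- by move=> x; rewrite f'E inE.
- by move=> x; rewrite g'E inE.
move=> b ->; apply: (subalgebraZ _ (generated_subalgebraP _)).
by apply: generated_subalgebra_gen; exists f', g'.
Qed.

(** The minor is indexed by sets, since the orderings [f] and [g] affect it only by a sign;
    [initial_minor_uniq] makes [u] a function of [I] and [J]. *)
Definition initial_minor I J u : Prop :=
  exists k (f : 'I_k -> 'I_m) (g : 'I_k -> 'I_n),
    [/\ injective f, injective g, codom f =i I, codom g =i J
      & is_initial_monomial le (minor K f g) u].

Lemma initial_minor_uniq I J u v : initial_minor I J u -> initial_minor I J v -> u = v.
Proof.
move=> [k [f [g [fi gi fI gJ fgu]]]] [k' [f' [g' [fi' gi' fI' gJ' fgv]]]].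
have ? : k' = k by rewrite -(inj_card_codom fi fI) -(inj_card_codom fi' fI').
subst k'; have [||b e] := minor_same_codom K fi fi' gi gi'.
- by move=> x; rewrite fI fI'.
- by move=> x; rewrite gJ gJ'.
by move: fgu; rewrite e => /initial_sign fgu; apply: initial_monomial_inj fgu fgv.
Qed.

Lemma initial_minor_exists I J : #|I| = #|J| -> exists u, initial_minor I J u.
Proof.
move=> IJ; have [f /increasing_inj fi fI] := increasing_enum (erefl #|I|).
have [g /increasing_inj gi gJ] := increasing_enum (esym IJ).
have [u fgu] := initial_monomial_exists le_mo (minor_neq0 K fi gi).
by exists u, #|I|, f, g.
Qed.

Lemma row_sum_initial_minor I J u r : initial_minor I J u -> row_sum u r = (r \in I).
Proof. by move=> [k [f [g [fi gi fI gJ [fgu _]]]]]; rewrite -fI (row_sum_minor _ fi fgu). Qed.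

Lemma col_sum_initial_minor I J u c : initial_minor I J u -> col_sum u c = (c \in J).
Proof. by move=> [k [f [g [fi gi fI gJ [fgu _]]]]]; rewrite -gJ (col_sum_minor _ gi fgu). Qed.

Lemma mdeg_initial_minor I J u : initial_minor I J u -> mdeg u = #|I|.
Proof.
move=> iu; rewrite mdeg_row_sum -sum1_card [RHS]big_mkcond /=.
by apply: eq_bigr => r _; rewrite (row_sum_initial_minor _ iu); case: ifP.
Qed.

Lemma initial_exponents_minors t u : initial_exponents le (@minors K m n t) u ->
  exists I J, [/\ #|I| = t, #|J| = t & initial_minor I J u].
Proof.
move=> [_ [f [g [/increasing_inj fi /increasing_inj gi ->]]] fgu].
exists [set x in codom f], [set x in codom g].
have fE : codom f =i [set x in codom f] by move=> x; rewrite inE.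
have gE : codom g =i [set x in codom g] by move=> x; rewrite inE.
by split; [exact: inj_card_codom fE | exact: inj_card_codom gE | exists t, f, g].
Qed.

(* Jacobi's identity writes the product as the determinant of a 2 x 2 matrix
   of t-minors. *)
Lemma minors_algebra_jacobi p (f : 'I_(2 + p) -> 'I_m) (g : 'I_(2 + p) -> 'I_n) :
  injective f -> injective g ->
  minors_algebra p.+1 (minor K f g * minor K (f \o @rshift 2 p) (g \o @rshift 2 p)).
Proof.
move=> fi gi; set Y := mxsub f g (generic_matrix K m n).
have -> : minor K (f \o @rshift 2 p) (g \o @rshift 2 p) = \det (drsubmx Y).
  by congr (\det _); apply/matrixP => i j; rewrite !mxE.
rewrite [minor K f g]/(\det Y) det_adj_ulsubmx ?minor_neq0 //.
have sA : subalgebra (@minors_algebra K m n p.+1) by apply: generated_subalgebraP.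
apply: subalgebra_det => // i j; rewrite !mxE /cofactor.
rewrite -signr_odd; case: (sA) => A1 _ AM; apply: AM.
  by case: odd; rewrite ?expr1 -?scaleN1r //; apply: (subalgebraZ _ sA).
set a := lshift p j; set b := lshift p i.
have -> : row' a (col' b Y) = mxsub (f \o lift a) (g \o lift b) (generic_matrix K m n).
  by apply/matrixP => x y; rewrite !mxE.
apply: (@minors_minor p.+1 (f \o lift a) (g \o lift b)).
  by apply: inj_comp fi _; apply: lift_inj.
by apply: inj_comp gi _; apply: lift_inj.
Qed.

End InitialMinors.

(** Puts [a] and [b] in front, so that the lower right block in Jacobi's identity is the minor that
    omits them. *)
Lemma enum_two_first k p (A : {set 'I_k}) a b :
    #|A| = p.+2 -> a \in A -> b \in A -> a != b ->
  exists f : 'I_(2 + p) -> 'I_k,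
    [/\ injective f, codom f =i A & codom (f \o @rshift 2 p) =i A :\ a :\ b].
Proof.
move=> Ap aA bA ab; set r := enum (A :\ a :\ b).
have szr : size r = p.
  rewrite -cardE; apply/eqP; have := Ap.
  by rewrite (cardsD1 a) aA (cardsD1 b (A :\ a)) !inE eq_sym ab bA !add1n => -[->].
pose s := [:: a, b & r].
have us : uniq s.
  by rewrite /= !inE !mem_enum !inE (negbTE ab) !eqxx ?andbF /= enum_uniq.
have szs : size s = (2 + p)%N by rewrite /= szr.
exists (fun x => nth a s x); split=> [x y /eqP|x|x].
- by rewrite nth_uniq ?szs // => /eqP /val_inj.
- apply/codomP/idP => [[y ->]|xA].
    have : nth a s y \in s by rewrite mem_nth // szs.
    by rewrite !inE mem_enum !inE => /or3P[/eqP->|/eqP->|/and3P[]].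
  have /(nthP a)[y ys <-] : x \in s.
    by rewrite !inE mem_enum !inE xA andbT; case: (x == a); case: (x == b).
  by rewrite szs in ys; exists (Ordinal ys).
have -> : (x \in A :\ a :\ b) = (x \in r) by rewrite mem_enum.
apply/codomP/idP => [[y ->]|].
  by change (nth a r y \in r); rewrite mem_nth ?szr //.
move=> /(nthP a)[y yr <-]; rewrite szr in yr.
by exists (Ordinal yr).
Qed.

(** * Necessity *)

Section MatchingSupport.
Variables (K : fieldType) (m n : nat) (le : rel 'X_{1..m * n}).
Local Notation ix := (@mxvec_index m n).
Variables (I : {set 'I_m}) (J : {set 'I_n}) (u : 'X_{1..m * n}).
Hypothesis iu : initial_minor K le I J u.

(** All row and column sums of [u] are 0 or 1, so the positions of positive exponent are the edges
    of a perfect matching between [I] and [J]. The lemmas of this section express this edge by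
    edge. *)
Lemma initial_minor_mem i j : (0 < u (ix i j))%N -> (i \in I) && (j \in J).
Proof.
move=> u0; have := leq_trans u0 (leq_row_sum u i j).
have := leq_trans u0 (leq_col_sum u i j).
rewrite (row_sum_initial_minor _ iu) (col_sum_initial_minor _ iu).
by case: (j \in J); case: (i \in I).
Qed.

Lemma initial_minor_row i : i \in I -> exists j, (0 < u (ix i j))%N.
Proof.
move=> iI; apply/existsP; rewrite -[[exists _, _]]negbK negb_exists; apply/negP => /forallP u0.
have := row_sum_initial_minor i iu; rewrite iI /row_sum big1 // => j _.
by apply/eqP; rewrite -leqn0 leqNgt u0.
Qed.

Lemma initial_minor_col j : j \in J -> exists i, (0 < u (ix i j))%N.
Proof.
move=> jJ; apply/existsP; rewrite -[[exists _, _]]negbK negb_exists; apply/negP => /forallP u0.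
have := col_sum_initial_minor j iu; rewrite jJ /col_sum big1 // => i _.
by apply/eqP; rewrite -leqn0 leqNgt u0.
Qed.

Lemma initial_minor_row_inj i j j' :
  (0 < u (ix i j))%N -> (0 < u (ix i j'))%N -> j = j'.
Proof.
move=> u0 u0'; apply/eqP; apply: contraT => jj'.
have := row_sum_initial_minor i iu; rewrite /row_sum (bigD1 j) //= (bigD1 j') 1?eq_sym //=.
by case: (u (ix i j)) u0 => // a _; case: (u (ix i j')) u0' => // b _;
  case: (i \in I); rewrite !addSn ?addnS.
Qed.

Lemma initial_minor_col_inj i i' j :
  (0 < u (ix i j))%N -> (0 < u (ix i' j))%N -> i = i'.
Proof.
move=> u0 u0'; apply/eqP; apply: contraT => ii'.
have := col_sum_initial_minor j iu; rewrite /col_sum (bigD1 i) //= (bigD1 i') 1?eq_sym //=.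
by case: (u (ix i j)) u0 => // a _; case: (u (ix i' j)) u0' => // b _;
  case: (j \in J); rewrite !addSn ?addnS.
Qed.

End MatchingSupport.

Section NotSagbi.
Variables (K : fieldType) (m n p : nat) (le : rel 'X_{1..m * n}).
Hypothesis le_mo : monomial_order le.
Hypothesis sagbi : sagbi_basis le (@minors K m n p.+1) (@minors_algebra K m n p.+1).
Local Notation ix := (@mxvec_index m n).
Local Notation initial_minor := (initial_minor K le).
Implicit Types (R : {set 'I_m}) (C D : {set 'I_n}) (u v w : 'X_{1..m * n}).

(** The product of the two minors lies in the algebra by Jacobi's identity, so the Sagbi property
    applies to its initial monomial. *)
Lemma initial_minor_pair R C u v i k j l :
    #|R| = p.+2 -> #|C| = p.+2 -> i \in R -> k \in R -> i != k ->
    j \in C -> l \in C -> j != l ->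
    initial_minor R C u -> initial_minor (R :\ i :\ k) (C :\ j :\ l) v ->
  monoid_gen (initial_exponents le (@minors K m n p.+1)) (u + v)%MM.
Proof.
move=> Rp Cp iR kR ik jC lC jl iu iv.
have [f [fi fR fR']] := enum_two_first Rp iR kR ik.
have [g [gi gC gC']] := enum_two_first Cp jC lC jl.
have fi' : injective (f \o @rshift 2 p) by apply: inj_comp fi _; apply: rshift_inj.
have gi' : injective (g \o @rshift 2 p) by apply: inj_comp gi _; apply: rshift_inj.
have [u' u'P] := initial_monomial_exists le_mo (minor_neq0 K fi gi).
have [v' v'P] := initial_monomial_exists le_mo (minor_neq0 K fi' gi').
have <- : u' = u by apply: (initial_minor_uniq le_mo) iu; exists (2 + p)%N, f, g.
have <- : v' = v.
  by apply: (initial_minor_uniq le_mo) iv; exists p, (f \o @rshift 2 p), (g \o @rshift 2 p).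
apply: (sagbi_basis_elim sagbi); first exact: (minors_algebra_jacobi fi gi).
exact: initial_monomialM.
Qed.

(** Multiply by the initial monomial [v] of the minor omitting the rows [i], [k] and the columns
    [j], [l]. The product splits into two initial monomials of minors, and counting rows and columns
    shows that the one containing the edge [(k, l)] belongs to [R :\ i] and [C :\ j], hence is
    [w]. *)
Lemma initial_minor_star R C u w i k j l :
    #|R| = p.+2 -> #|C| = p.+2 -> i \in R -> i != k -> j \in C -> j != l ->
    initial_minor R C u -> (0 < u (ix k l))%N ->
    initial_minor (R :\ i) (C :\ j) w ->
  (0 < w (ix k l))%N.
Proof.
move=> Rp Cp iR ik jC jl iu ukl iw.
have /andP[kR lC] := initial_minor_mem iu ukl.
have cR : #|R :\ i :\ k| = p.
  apply/eqP; move: Rp; rewrite (cardsD1 i) iR (cardsD1 k (R :\ i)) !inE eq_sym ik kR.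
  by rewrite !add1n => -[->].
have cC : #|C :\ j :\ l| = p.
  apply/eqP; move: Cp; rewrite (cardsD1 j) jC (cardsD1 l (C :\ j)) !inE eq_sym jl lC.
  by rewrite !add1n => -[->].
have [v iv] := initial_minor_exists K le_mo (etrans cR (esym cC)).
have [s sP uvE] := initial_minor_pair Rp Cp iR kR ik jC lC jl iu iv.
(* The total degree is [p.+2 + p], twice the degree of a generator, so exactly two generators
   occur. *)
have deg : (p.+1 * size s = p.+1 * 2)%N.
  have := congr1 (@mdeg _) uvE; rewrite mdegD (mdeg_initial_minor iu) (mdeg_initial_minor iv).
  rewrite Rp cR mdeg_sum (eq_big_seq (fun=> p.+1)).
    by rewrite big_const_seq count_predT iter_addn addn0 muln2 -addnn addSnnS => ->.
  by move=> x /sP /initial_exponents_minors [I [J [Ip _ /mdeg_initial_minor->]]].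
have {deg} szs : size s = 2 by apply/eqP; rewrite -(eqn_pmul2l (ltn0Sn p)) deg.
case: s szs sP uvE => [//|u1 [//|u2 [|//]]] _ sP uvE.
have [I1 [J1 [cI1 cJ1 iu1]]] : exists (I : {set 'I_m}) (J : {set 'I_n}),
    [/\ #|I| = p.+1, #|J| = p.+1 & initial_minor I J u1].
  by apply: initial_exponents_minors; apply: sP; rewrite !inE eqxx.
have [I2 [J2 [cI2 cJ2 iu2]]] : exists (I : {set 'I_m}) (J : {set 'I_n}),
    [/\ #|I| = p.+1, #|J| = p.+1 & initial_minor I J u2].
  by apply: initial_exponents_minors; apply: sP; rewrite !inE eqxx orbT.
rewrite big_cons big_seq1 in uvE.
(* The edge [(k, l)] of [u] occurs in at least one of the two factors, which play symmetric
   roles. *)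
wlog u1kl : u1 u2 I1 I2 J1 J2 cI1 cI2 cJ1 cJ2 iu1 iu2 {sP} uvE / (0 < u1 (ix k l))%N => [wl|].
  have [u1kl|] := ltnP 0 (u1 (ix k l)); first exact: (wl u1 u2 I1 I2 J1 J2).
  rewrite leqn0 => /eqP u1kl; apply: (wl u2 u1 I2 I1 J2 J1) => //; first by rewrite uvE addmC.
  move/(congr1 (fun x : 'X_{1..m * n} => x (ix k l))): uvE; rewrite !mnmDE u1kl add0n => <-.
  by rewrite addn_gt0 ukl.
have /andP[kI1 lJ1] := initial_minor_mem iu1 u1kl.
have rE x : ((x \in R) + (x \in R :\ i :\ k) = (x \in I1) + (x \in I2))%N.
  have := congr1 (fun z => @row_sum m n z x) uvE; rewrite !row_sumD.
  rewrite (row_sum_initial_minor _ iu) (row_sum_initial_minor _ iv).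
  by rewrite (row_sum_initial_minor _ iu1) (row_sum_initial_minor _ iu2).
have cE x : ((x \in C) + (x \in C :\ j :\ l) = (x \in J1) + (x \in J2))%N.
  have := congr1 (fun z => @col_sum m n z x) uvE; rewrite !col_sumD.
  rewrite (col_sum_initial_minor _ iu) (col_sum_initial_minor _ iv).
  by rewrite (col_sum_initial_minor _ iu1) (col_sum_initial_minor _ iu2).
(* Row [k] is counted once in [u + v] and is already taken by [u1], so [I2] misses it; the
   cardinality then leaves only [R :\ k]. *)
have I2E : I2 = R :\ k.
  apply/eqP; rewrite eqEcard; apply/andP; split; last first.
    by rewrite cI2; move: Rp; rewrite (cardsD1 k) kR add1n => -[->].
  apply/subsetP => x; have := rE x; rewrite !inE; have [->|_] := eqVneq x k.
    by rewrite kR kI1 /=; case: (k \in I2).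
  by case: (x \in R); case: (x \in I1); case: (x \in I2); case: eqP.
have J2E : J2 = C :\ l.
  apply/eqP; rewrite eqEcard; apply/andP; split; last first.
    by rewrite cJ2; move: Cp; rewrite (cardsD1 l) lC add1n => -[->].
  apply/subsetP => x; have := cE x; rewrite !inE; have [->|_] := eqVneq x l.
    by rewrite lC lJ1 /=; case: (l \in J2).
  by case: (x \in C); case: (x \in J1); case: (x \in J2); case: eqP.
have I1E : I1 = R :\ i.
  apply/setP => x; have := rE x; rewrite I2E !inE; have [->|_] := eqVneq x k.
    by rewrite kR kI1 eq_sym ik.
  by case: (x \in R); case: (x \in I1); case: eqP.
have J1E : J1 = C :\ j.
  apply/setP => x; have := cE x; rewrite J2E !inE; have [->|_] := eqVneq x l.
    by rewrite lC lJ1 eq_sym jl.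
  by case: (x \in C); case: (x \in J1); case: eqP.
by subst I1 J1; rewrite (initial_minor_uniq le_mo iw iu1).
Qed.

(** Both matchings are compared with that of the common minor on [R :\ i] and [D :\ c :\ c']. If
    [u'] does not send row [k] to [c], any row [i] other than [k] works, because two edges of row
    [k] in [w] coincide. Otherwise the edge of [u'] in column [l] is compared, with [i] avoiding
    both rows involved. *)
Lemma initial_minor_agree R D u u' c c' k l :
    (0 < p)%N -> #|R| = p.+2 -> #|D| = p.+3 -> c \in D -> c' \in D -> c != c' ->
    initial_minor R (D :\ c) u -> initial_minor R (D :\ c') u' ->
    (0 < u (ix k l))%N -> l != c' ->
  (0 < u' (ix k l))%N.
Proof.
move=> p0 Rp Dp cD c'D cc' iu iu' ukl lc'.
have Dcp : #|D :\ c| = p.+2 by move: Dp; rewrite (cardsD1 c) cD add1n => -[].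
have Dc'p : #|D :\ c'| = p.+2 by move: Dp; rewrite (cardsD1 c') c'D add1n => -[].
have /andP[kR] := initial_minor_mem iu ukl; rewrite !inE => /andP[lc lD].
have common i : i \in R -> exists w, [/\ initial_minor (R :\ i) (D :\ c :\ c') w,
    forall a b, (0 < u (ix a b))%N -> i != a -> b != c' -> (0 < w (ix a b))%N
  & forall a b, (0 < u' (ix a b))%N -> i != a -> b != c -> (0 < w (ix a b))%N].
  move=> iR; have cE : #|R :\ i| = #|D :\ c :\ c'|.
    move: Rp Dcp; rewrite (cardsD1 i) iR (cardsD1 c' (D :\ c)) !inE eq_sym cc' c'D.
    by rewrite !add1n => -[->] [->].
  have [w iw] := initial_minor_exists K le_mo cE; exists w; split=> // a b uab ia bc.
    apply: (initial_minor_star Rp Dcp iR ia _ _ iu uab iw); last by rewrite eq_sym.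
    by rewrite !inE eq_sym cc'.
  apply: (initial_minor_star Rp Dc'p iR ia (j := c) _ _ iu' uab); last first.
  - by move: iw; congr (initial_minor _ _ _); apply/setP => x; rewrite !inE andbCA.
  - by rewrite eq_sym.
  by rewrite !inE cc'.
have [l' u'kl'] := initial_minor_row iu' kR.
(* Since [p > 0], [R] has at least three rows, which leaves one outside any two. *)
have pick a b : a \in R -> exists i, [/\ i \in R, i != a & i != b].
  move=> aR; have : (0 < #|R :\ a :\ b|)%N.
    move: Rp; rewrite (cardsD1 a) aR (cardsD1 b (R :\ a)) add1n => -[].
    by case: (b \in _) => /=; [rewrite add1n => -[->] | rewrite add0n => ->].
  by rewrite card_gt0 => /set0Pn [i]; rewrite !inE => /and3P[ib ia iR]; exists i.
have [l'c|l'c] := eqVneq l' c; last first.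
  have [i [iR ik _]] := pick k k kR; have [w [iw wu wu']] := common i iR.
  by rewrite (initial_minor_row_inj iw (wu _ _ ukl ik lc') (wu' _ _ u'kl' ik l'c)).
have lDc' : l \in D :\ c' by rewrite !inE lc'.
have [k' u'k'l] := initial_minor_col iu' lDc'.
have [i [iR ik ik']] := pick k k' kR; have [w [iw wu wu']] := common i iR.
by rewrite (initial_minor_col_inj iw (wu _ _ ukl ik lc') (wu' _ _ u'k'l ik' lc)).
Qed.

(** Let [u0], [u1], [u2] be the matchings that omit the columns [c0], [c1], [c2], and let [u0] match
    [a1] with [c1]. Then [u2] also matches [a1] with [c1]. The column [b] matched with [a1] in [u1]
    differs from [c2], so it is passed on to [u2] as well. This forces [b = c1], a column that [u1]
    omits. *)
Lemma minors_not_sagbi R D : (0 < p)%N -> #|R| = p.+2 -> #|D| = p.+3 -> False.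
Proof.
move=> p0 Rp Dp.
have pick (A : {set 'I_n}) k : #|A| = k.+1 -> exists2 c, c \in A & #|A :\ c| = k.
  move=> Ak; have /set0Pn [c cA] : A != set0 by rewrite -card_gt0 Ak.
  by exists c => //; move: Ak; rewrite (cardsD1 c) cA add1n => -[].
have [c0 c0D D0] := pick _ _ Dp; have [c1 c1D D1] := pick _ _ D0.
have [c2 c2D _] := pick _ _ D1.
move: c1D c2D; rewrite !inE => /andP[c10 c1D] /and3P[c21 c20 c2D].
have card_D1 c : c \in D -> #|R| = #|D :\ c|.
  by move=> cD; rewrite Rp; move: Dp; rewrite (cardsD1 c) cD add1n => -[].
have [u0 iu0] := initial_minor_exists K le_mo (card_D1 _ c0D).
have [u1 iu1] := initial_minor_exists K le_mo (card_D1 _ c1D).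
have [u2 iu2] := initial_minor_exists K le_mo (card_D1 _ c2D).
have [|a1 u0a1] := initial_minor_col iu0 (j := c1); first by rewrite !inE c10.
have [|a2 u0a2] := initial_minor_col iu0 (j := c2); first by rewrite !inE c20.
have u1a2 : (0 < u1 (ix a2 c2))%N.
  by apply: (initial_minor_agree p0 Rp Dp c0D c1D _ iu0 iu1 u0a2); rewrite // eq_sym.
have u2a1 : (0 < u2 (ix a1 c1))%N.
  by apply: (initial_minor_agree p0 Rp Dp c0D c2D _ iu0 iu2 u0a1); rewrite // eq_sym.
have a1R : a1 \in R by case/andP: (initial_minor_mem iu0 u0a1).
have [b u1a1b] := initial_minor_row iu1 a1R.
have bc2 : b != c2.
  apply: contraNneq c21 => bE; rewrite bE in u1a1b.
  have a12 := initial_minor_col_inj iu1 u1a1b u1a2; rewrite a12 in u0a1.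
  by rewrite (initial_minor_row_inj iu0 u0a1 u0a2).
have u2a1b : (0 < u2 (ix a1 b))%N.
  by apply: (initial_minor_agree p0 Rp Dp c1D c2D _ iu1 iu2 u1a1b); rewrite // eq_sym.
have bc1 := initial_minor_row_inj iu2 u2a1b u2a1.
by have := initial_minor_mem iu1 u1a1b; rewrite bc1 !inE eqxx andbF.
Qed.

End NotSagbi.

(** * The cases t = 1 and m = n = t + 1 *)

Section IndependentInitials.
Variables (K : fieldType) (N r : nat) (le : rel 'X_{1..N}).
Hypothesis le_mo : monomial_order le.
Variables (F : 'I_r -> {mpoly K[N]}) (e : 'I_r -> 'X_{1..N}).
Hypothesis initF : forall k, is_initial_monomial le (F k) (e k).

Let E (a : 'X_{1..r}) : 'X_{1..N} := (\sum_k e k *+ a k)%MM.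

(* Distinct monomials in the F k have distinct initial monomials, so no
   cancellation occurs among them. *)
Lemma independent_initial (P : {mpoly K[r]}) u : injective E ->
  is_initial_monomial le (P \mPo [tuple F k | k < r]) u -> exists a, u = E a.
Proof.
move=> E_inj uP; pose G (a : 'X_{1..r}) := \prod_k F k ^+ a k.
have initG a : is_initial_monomial le (G a) (E a).
  by apply: (initial_monomial_prod le_mo) => k _.
have PE : P \mPo [tuple F k | k < r] = \sum_(a <- msupp P) P@_a *: G a.
  rewrite comp_mpolyE; apply: eq_bigr => a _; congr (_ *: _).
  by apply: eq_bigr => k _; rewrite tnth_mktuple.
have [P0|/(max_exists le_mo E) [a aP amax]] := eqVneq (msupp P) [::].
  by move: uP; rewrite PE P0 big_nil => -[]; rewrite -mpolyC0 msupp0.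
exists a; apply: (initial_monomial_inj le_mo uP); rewrite PE; split.
  rewrite mcoeff_msupp raddf_sum /= (bigD1_seq a) ?msupp_uniq //= big_seq_cond big1 ?addr0.
    by rewrite mcoeffZ mulf_neq0 // -mcoeff_msupp //; case: (initG a).
  (* If [E a] occurred in [G b], then [E a] would be at most [E b], hence equal to it by maximality,
     and [b = a] by injectivity. *)
  move=> b /andP[bP ba]; rewrite mcoeffZ [X in _ * X]memN_msupp_eq0 ?mulr0 //.
  apply/negP => /(proj2 (initG b)) ab; case/eqP: ba; apply: E_inj.
  by case: le_mo => _ asym _ _ _; apply: asym; rewrite ab amax.
move=> v /msupp_sum_le /flattenP [y /mapP[b]].
rewrite mem_filter => bP -> /msuppZ_le /(proj2 (initG b)) vb.
by case: le_mo => _ _ tr _ _; apply: tr vb _; apply: amax.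
Qed.

End IndependentInitials.

(** The 1-minors are the variables, and every monomial is a product of variables; any monomial order
    would do. *)
Lemma variables_sagbi (K : fieldType) (m n : nat) :
  exists le : rel 'X_{1..m * n},
    monomial_order le /\ sagbi_basis le (@minors K m n 1) (@minors_algebra K m n 1).
Proof.
pose le := lex_le (fun k : 'I_(m * n) => val k).
have le_mo : monomial_order le by apply: lex_le_mo; apply: val_inj.
exists le; split=> //; apply: sagbi_basis_intro => //.
- exact: generated_subalgebraP.
- by move=> f Ff; apply: generated_subalgebra_gen.
move=> _ u _ _; rewrite (multinomUE_id u).
apply: big_ind => [||k _]; [exact: monoid_gen0 | exact: monoid_genD |].
elim: (u k) => [|d IHd]; first by rewrite mulm0n; apply: monoid_gen0.
rewrite mulmS; apply: monoid_genD IHd; apply: monoid_gen1.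
exists 'X_k; last exact: initial_monomialX.
case/mxvec_indexP: k => i j; exists (fun=> i), (fun=> j).
by split; [move=> x y; rewrite !ord1 | move=> x y; rewrite !ord1 | rewrite det_mx11 !mxE].
Qed.

(** * The minors of size t of a square matrix of size t + 1 *)

Section Submaximal.
Variables (K : fieldType) (t : nat).
Local Notation n := t.+1.
Local Notation ix := (@mxvec_index n n).
Implicit Types (i j : 'I_n).

(** The offset [n * n] exceeds every index, so all off-diagonal variables come after the diagonal
    ones. *)
Definition diagonal_first (k : 'I_(n * n)) : nat :=
  if [exists a, k == ix a a] then val k else (n * n + k)%N.

Lemma diagonal_first_inj : injective diagonal_first.
Proof.
move=> k l; rewrite /diagonal_first; do 2!case: ifP => _.
- by move/val_inj.
- by move=> e; have := ltn_ord k; rewrite e ltnNge leq_addr.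
- by move=> e; have := ltn_ord l; rewrite -e ltnNge leq_addr.
by move/addnI/val_inj.
Qed.

Lemma diagonal_first_lt a i j : i != j -> (diagonal_first (ix a a) < diagonal_first (ix i j))%N.
Proof.
move=> ij; rewrite /diagonal_first.
have -> : [exists b, ix a a == ix b b] by apply/existsP; exists a.
case: existsP => [[b]|_]; last exact: leq_trans (ltn_ord _) (leq_addr _ _).
by rewrite mxvec_index_eq => /andP[/eqP ib /eqP jb]; rewrite ib jb eqxx in ij.
Qed.

Let le := lex_le diagonal_first.

Lemma codom_lift (i : 'I_n) x : (x \in codom (lift i)) = (x != i).
Proof.
apply/codomP/idP => [[y ->]|]; first by rewrite eq_sym neq_lift.
by rewrite eq_sym => /unlift_some [y -> _]; exists y.
Qed.

Lemma codom_omit_one (f : 'I_t -> 'I_n) : injective f -> exists i, codom f =i codom (lift i).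
Proof.
move=> fi; have : #|~: [set x in codom f]| = 1%N.
  have fE : codom f =i [set x in codom f] by move=> x; rewrite inE.
  have := cardsC [set x in codom f]; rewrite (inj_card_codom fi fE) card_ord.
  by move=> e; apply: (@addnI t); rewrite e addn1.
move=> /eqP /cards1P [i iE]; exists i => x; rewrite codom_lift.
by have /setP /(_ x) := iE; rewrite !inE => <-; rewrite negbK.
Qed.

(* The monomial x_(j,i) prod_(k <> i, j) x_(k,k) if i <> j, and
   prod_(k <> i) x_(k,k) if i = j. *)
Definition near_diagonal i j : 'X_{1..n * n} :=
  matching_mnm (lift i) (tperm i j \o lift i) 1%g.

Lemma near_diagonalE i j a b :
  near_diagonal i j (ix a b) = (a != i) && (tperm i j a == b).
Proof.
have [->|ai] := eqVneq a i; last first.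
  have /unlift_some [x -> _] : i != a by rewrite eq_sym.
  by rewrite matching_mnmE ?perm1 //; apply: lift_inj.
rewrite mnm_sumE big1 // => x _; rewrite mnm1E mxvec_index_eq.
by rewrite eq_sym (negbTE (neq_lift _ _)).
Qed.

(** Suppose a monomial [v] of the minor exceeds [near_diagonal i j] at their first difference
    [(a, b)]. This position is off the diagonal, so [v] contains all [x_(k,k)] with [k] different
    from [i] and [j]. Row and column sums then leave only [a = j] and [b = i], where
    [near_diagonal i j] has the same exponent. *)
Lemma initial_submaximal i j :
  is_initial_monomial le (minor K (lift i) (lift j)) (near_diagonal i j).
Proof.
have gi : injective (tperm i j \o lift i) by apply: inj_comp perm_inj _; apply: lift_inj.
split.
  have jE : codom (lift j) =i codom (tperm i j \o lift i).
    move=> x; rewrite codom_lift; apply/idP/codomP => [xj|[y ->]] /=; last first.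
      by rewrite -{2}(tpermL i j) (inj_eq perm_inj) eq_sym neq_lift.
    have : i != tperm i j x by rewrite -{1}(tpermR i j) (inj_eq perm_inj) eq_sym.
    by move=> /unlift_some [y yE _]; exists y; rewrite -yE tpermK.
  have [b ->] := minor_same_codom K (@lift_inj _ i) (@lift_inj _ i) (@lift_inj _ j) gi
    (fun=> erefl) jE.
  have e (c : bool) (p : {mpoly K[n * n]}) v : v \in msupp p -> v \in msupp ((-1) ^+ c *: p).
    by rewrite !mcoeff_msupp mcoeffZ mulf_eq0 signr_eq0.
  by apply: e; apply: matching_mnm_supp => //; apply: lift_inj.
move=> v vs.
have rv x : row_sum v x = (x != i).
    by rewrite (row_sum_minor _ _ vs) ?codom_lift //; apply: lift_inj.
have cv y : col_sum v y = (y != j).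
    by rewrite (col_sum_minor _ _ vs) ?codom_lift //; apply: lift_inj.
apply/lex_leP; have [->|/(first_difference diagonal_first) [k vk h]] :=
  eqVneq v (near_diagonal i j).
  by left.
right; exists k => //; case: ltngtP vk => // + _.
case/mxvec_indexP: k h => a b h; rewrite near_diagonalE => vab.
have va := leq_row_sum v a b; have vb := leq_col_sum v a b.
rewrite rv in va; rewrite cv in vb.
have ai : a != i by case: eqP va vab => // _; rewrite leqn0 => /eqP->.
have bj : b != j by case: eqP vb vab => // _; rewrite leqn0 => /eqP->.
rewrite ai bj /= in va vb vab.
have {va vb} vab1 : v (ix a b) = 1%N.
  by apply/eqP; rewrite eqn_leq va (leq_trans _ vab).
have {vab} star0 : tperm i j a != b by case: eqP vab => //; rewrite vab1.
have ab : a != b.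
  by apply: contraNneq star0 => ab; rewrite -ab in bj *; rewrite tpermD // eq_sym.
have vd x : x != i -> x != j -> v (ix x x) = 1%N.
  move=> xi xj; rewrite h ?diagonal_first_lt // near_diagonalE xi.
  by rewrite tpermD ?eqxx // eq_sym.
have [aj|aj] := eqVneq a j; last first.
  have := rv a; rewrite ai /row_sum (bigD1 a) //= (bigD1 b) 1?eq_sym //=.
  by rewrite vd // vab1.
have [bi|bi] := eqVneq b i; last first.
  have := cv b; rewrite bj /col_sum (bigD1 a) //= (bigD1 b) 1?eq_sym //=.
  by rewrite vd // vab1.
by move: star0; rewrite aj bi tpermR eqxx.
Qed.

Lemma near_diagonal_sumE (a : 'X_{1..n * n}) x y :
  (\sum_k (mxvec (\matrix_(i, j) near_diagonal i j) ord0 k) *+ a k)%MM (ix x y) =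
  if x == y then (\sum_(i | i != x) \sum_(j | j != x) a (ix i j))%N else a (ix y x).
Proof.
transitivity (\sum_i \sum_j near_diagonal i j (ix x y) * a (ix i j))%N.
  rewrite mnm_sumE pair_big (reindex (uncurry ix)) /=; last exact: curry_mxvec_bij.
  by apply: eq_bigr => [[i j] _]; rewrite mulmnE mxvecE mxE.
under eq_bigr do under eq_bigr do rewrite near_diagonalE.
have [<-|xy] := eqVneq x y.
  rewrite [RHS]big_mkcond /=; apply: eq_bigr => i _.
  have [->|xi] := eqVneq i x; first by rewrite big1 // => j _; rewrite eqxx.
  rewrite [RHS]big_mkcond; apply: eq_bigr => j _ /=.
  have [->|xj] := eqVneq j x; first by rewrite tpermR (negbTE xi).
  by rewrite tpermD // eqxx mul1n.
rewrite (bigD1 y) //= (bigD1 x) //= xy tpermR eqxx mul1n !big1 ?addn0 // => i ii.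
  rewrite big1 // => j _; have [->|xi] := eqVneq x i; first by [].
  have [->|xj] := eqVneq x j; first by rewrite tpermR (negbTE ii).
  by rewrite tpermD 1?eq_sym // eq_sym (negbTE xy).
by rewrite tpermD ?(negbTE xy) // eq_sym.
Qed.

(** The off-diagonal exponents determine the [a (ix i j)] with [i != j]. The diagonal ones then
    determine [S a - a (ix x x)] for every [x]. Summing over [x] gives [t] times [S a], hence [S a],
    and then each [a (ix x x)]. *)
Lemma near_diagonal_independent : (0 < t)%N ->
  injective (fun a : 'X_{1..n * n} =>
    (\sum_k (mxvec (\matrix_(i, j) near_diagonal i j) ord0 k) *+ a k)%MM).
Proof.
move=> t0 a b ab.
have {ab} abE x y := congr1 (fun z : 'X_{1..n * n} => z (ix x y)) ab.
have off x y : x != y -> a (ix y x) = b (ix y x).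
  by move=> xy; have := abE x y; rewrite /= !near_diagonal_sumE (negbTE xy).
pose S (c : 'X_{1..n * n}) := (\sum_i c (ix i i))%N.
have diag x : (S a + b (ix x x) = S b + a (ix x x))%N.
  suff T : (\sum_(i | i != x) a (ix i i) = \sum_(i | i != x) b (ix i i))%N.
    by rewrite /S (bigD1 x) //= [in RHS](bigD1 x) //= T addnAC [RHS]addnAC [(a _ + b _)%N]addnC.
  have split_diag (c : 'X_{1..n * n}) : (forall i j, i != j -> c (ix j i) = b (ix j i)) ->
      (\sum_(i | i != x) \sum_(j | j != x) c (ix i j) =
       \sum_(i | i != x) (\sum_(j | (j != x) && (j != i)) b (ix i j)) +
       \sum_(i | i != x) c (ix i i))%N.
    move=> cb; rewrite -big_split; apply: eq_bigr => i xi /=.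
    rewrite (bigD1 i) //= addnC; congr (_ + _)%N.
    by apply: eq_bigr => j /andP[_ ji]; apply: cb.
  have := abE x x; rewrite /= !near_diagonal_sumE eqxx !split_diag //.
  by move/addnI.
have SS : S a = S b.
  have : (\sum_(x < n) (S a + b (ix x x)) = \sum_(x < n) (S b + a (ix x x)))%N.
    by apply: eq_bigr => x _.
  rewrite !big_split /= !sum_nat_const card_ord !mulSn -/(S a) -/(S b).
  rewrite addnAC [in RHS]addnAC [(S b + S a)%N]addnC => /addnI /eqP.
  by rewrite eqn_pmul2l // => /eqP.
apply/mnm_matrixP => i j; have [<-|ij] := eqVneq i j; last by apply: off; rewrite eq_sym.
by have /eqP := diag i; rewrite SS eqn_add2l => /eqP.
Qed.

Lemma submaximal_sagbi : (0 < t)%N ->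
  exists le : rel 'X_{1..n * n},
    monomial_order le /\ sagbi_basis le (@minors K n n t) (@minors_algebra K n n t).
Proof.
move=> t0; have le_mo : monomial_order le by apply/lex_le_mo/diagonal_first_inj.
have sA := generated_subalgebraP (@minors K n n t).
exists le; split=> //; apply: sagbi_basis_intro => // [f|f u Af fu].
  exact: generated_subalgebra_gen.
pose F (k : 'I_(n * n)) := mxvec (\matrix_(i < n, j < n) @minor K n n t (lift i) (lift j)) 0 k.
pose e (k : 'I_(n * n)) := mxvec (\matrix_(i, j) near_diagonal i j) ord0 k.
have initF k : is_initial_monomial le (F k) (e k).
  by rewrite /F /e; case/mxvec_indexP: k => i j; rewrite !mxvecE !mxE; apply: initial_submaximal.
(* Polynomial expressions in the [F k] form a subalgebra, and each t-minor is some [F k] up to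
   sign. *)
have [P fE] : exists P, f = P \mPo [tuple F k | k < n * n].
  apply: (Af (fun f => exists P, f = P \mPo [tuple F k | k < n * n])); first split.
  - by exists 1; rewrite comp_mpoly1.
  - by move=> a _ _ [P ->] [Q ->]; exists (a *: P + Q); rewrite linearP.
  - by move=> _ _ [P ->] [Q ->]; exists (P * Q); rewrite rmorphM.
  move=> _ [g [h [/increasing_inj gi /increasing_inj hi ->]]].
  have [i gE] := codom_omit_one gi; have [j hE] := codom_omit_one hi.
  have [b gh] := minor_same_codom K gi (@lift_inj _ i) hi (@lift_inj _ j) gE hE.
  exists ((-1) ^+ b *: 'X_(ix i j)); rewrite linearZ /= comp_mpolyXU -tnth_nth tnth_mktuple.
  by rewrite /F mxvecE mxE -gh.
rewrite fE in fu; have [a ->] := independent_initial le_mo initF (near_diagonal_independent t0) fu.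
apply: big_ind => [||k _]; [exact: monoid_gen0 | exact: monoid_genD |].
elim: (a k) => [|d IHd]; first by rewrite mulm0n; apply: monoid_gen0.
rewrite mulmS; apply: monoid_genD IHd; rewrite /e.
case/mxvec_indexP: k => i j; rewrite mxvecE mxE.
have [g gi gE] :=
  @increasing_enum t n [set x in codom (lift i)]
    (inj_card_codom (@lift_inj _ i) (fun x => esym (in_set _ _))).
have [h hi hE] :=
  @increasing_enum t n [set x in codom (lift j)]
    (inj_card_codom (@lift_inj _ j) (fun x => esym (in_set _ _))).
apply: monoid_gen1; exists (minor K g h); first by exists g, h.
have gE' : codom g =i codom (lift i) by move=> x; rewrite gE inE.
have hE' : codom h =i codom (lift j) by move=> x; rewrite hE inE.
have [b ->] := minor_same_codom K (increasing_inj gi) (@lift_inj _ i)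
  (increasing_inj hi) (@lift_inj _ j) gE' hE'.
by apply/initial_sign; apply: initial_submaximal.
Qed.

End Submaximal.

(** * Row operations and initial monomials *)

Section Substitution.
Variables (K : fieldType) (N : nat).
Implicit Types (p q : {mpoly K[N]}) (g h : 'I_N -> {mpoly K[N]}) (u v : 'X_{1..N}).
Implicit Types (R : 'X_{1..N} -> 'X_{1..N} -> Prop).

Local Notation subst h p := (p \mPo [tuple h k | k < N]).

Lemma subst_comp h g p : subst g (subst h p) = subst (fun k => subst g (h k)) p.
Proof.
rewrite [subst h p]comp_mpolyEX linear_sum [RHS]comp_mpolyEX; apply: eq_bigr => v _.
rewrite linearZ /= !comp_mpolyX rmorph_prod; congr (_ *: _).
by apply: eq_bigr => k _; rewrite rmorphXn /= !tnth_mktuple.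
Qed.

(** [R] is meant to relate a monomial to the monomials of its image under the substitution. Being
    multiplicative, it need only be checked on the variables. *)
Definition subst_compatible h R : Prop :=
  [/\ R 0%MM 0%MM,
      forall a a' b b', R a a' -> R b b' -> R (a + b)%MM (a' + b')%MM
    & forall k v, v \in msupp (h k) -> R U_(k)%MM v].

Lemma subst_supp h R p v : subst_compatible h R -> v \in msupp (subst h p) ->
  exists2 u, u \in msupp p & R u v.
Proof.
move=> [R0 RD Rh]; rewrite comp_mpolyEX => /msupp_sum_le /flattenP [s /mapP[u]].
rewrite mem_filter => up -> /msuppZ_le; rewrite comp_mpolyX => uv; exists u => //.
have RS (I : Type) (r : seq I) (F : I -> {mpoly K[N]}) (e : I -> 'X_{1..N}) :
    (forall i w, w \in msupp (F i) -> R (e i) w) ->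
    forall w, w \in msupp (\prod_(i <- r) F i) -> R (\sum_(i <- r) e i)%MM w.
  move=> RF; elim: r => [|i r IHr] w.
    by rewrite !big_nil -mpolyC1 msupp1 inE => /eqP->.
  rewrite !big_cons => /msuppM_le /allpairsP[[a b] /= [aF bF ->]].
  by apply: RD; [apply: RF | apply: IHr].
rewrite (multinomUE_id u); apply: RS uv => k w; rewrite tnth_mktuple.
elim: (u k) w => [|d IHd] w; first by rewrite expr0 mulm0n -mpolyC1 msupp1 inE => /eqP->.
rewrite exprS mulmS => /msuppM_le /allpairsP[[a b] /= [aF bF ->]].
by apply: RD; [apply: Rh | apply: IHd].
Qed.

Definition mpoly_restrict (P : pred 'X_{1..N}) p : {mpoly K[N]} :=
  \sum_(v <- msupp p | P v) p@_v *: 'X_[v].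

Lemma mcoeff_restrict P p v : (mpoly_restrict P p)@_v = if P v then p@_v else 0.
Proof.
rewrite raddf_sum /=; have [vp|vp] := boolP (v \in msupp p); last first.
  rewrite (memN_msupp_eq0 vp) if_same big_seq_cond big1 // => w /andP[wp _].
  rewrite mcoeffZ mcoeffX; case: eqP => [e|]; last by rewrite mulr0.
  by rewrite e (negbTE vp) in wp.
rewrite big_mkcond (bigD1_seq v) ?msupp_uniq //= mcoeffZ mcoeffX eqxx mulr1.
rewrite big1 ?addr0 // => w /negbTE wv; case: ifP => // _.
by rewrite mcoeffZ mcoeffX wv mulr0.
Qed.

Lemma msupp_restrict P p v : (v \in msupp (mpoly_restrict P p)) = P v && (v \in msupp p).
Proof. by rewrite !mcoeff_msupp mcoeff_restrict; case: ifP; rewrite ?eqxx. Qed.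

(** As [P] is constant along [R], the substitution maps the part of [p] on [P] into [P] and the
    remaining part outside [P]. *)
Lemma restrict_subst h R (P : pred 'X_{1..N}) p :
  subst_compatible h R -> (forall u v, R u v -> P u = P v) ->
  mpoly_restrict P (subst h p) = subst h (mpoly_restrict P p).
Proof.
move=> hR RP; have pE : p = mpoly_restrict P p + mpoly_restrict (predC P) p.
  apply/mpolyP => v; rewrite mcoeffD !mcoeff_restrict /=.
  by case: (P v); rewrite ?addr0 ?add0r.
apply/mpolyP => v; rewrite mcoeff_restrict [in LHS]pE rmorphD mcoeffD /=.
case: ifP => Pv.
  rewrite [X in _ + X]memN_msupp_eq0 ?addr0 //; apply/negP => /(subst_supp hR) [u].
  by rewrite msupp_restrict /= => /andP[Pu _] /RP; rewrite Pv (negbTE Pu).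
rewrite memN_msupp_eq0 //; apply/negP => /(subst_supp hR) [u].
by rewrite msupp_restrict => /andP[Pu _] /RP; rewrite Pv Pu.
Qed.

Lemma msupp_XDZX (c : K) k l v : v \in msupp ('X_k + c *: 'X_l : {mpoly K[N]}) ->
  v = U_(k)%MM \/ v = U_(l)%MM.
Proof.
move=> /msuppD_le; rewrite mem_cat msuppX inE => /orP[/eqP->|]; first by left.
by move=> /msuppZ_le; rewrite msuppX inE => /eqP->; right.
Qed.

End Substitution.

Section MatrixSubstitution.
Variables (K : fieldType) (m n : nat).
Local Notation ix := (@mxvec_index m n).
Implicit Types (u v w : 'X_{1..m * n}) (p f h : {mpoly K[m * n]}).
Implicit Types (H G : 'M[{mpoly K[m * n]}]_(m, n)) (R : 'X_{1..m * n} -> 'X_{1..m * n} -> Prop).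

Definition msub H p : {mpoly K[m * n]} := p \mPo [tuple mxvec H ord0 k | k < m * n].

Lemma msub_compatible H R :
    R 0%MM 0%MM -> (forall a a' b b', R a a' -> R b b' -> R (a + b)%MM (a' + b')%MM) ->
    (forall a b v, v \in msupp (H a b) -> R U_(ix a b)%MM v) ->
  subst_compatible (mxvec H ord0) R.
Proof.
by move=> R0 RD RH; split=> // k v; case/mxvec_indexP: k => a b; rewrite mxvecE; apply: RH.
Qed.

Lemma msubX H a b : msub H 'X_(ix a b) = H a b.
Proof. by rewrite /msub comp_mpolyXU -tnth_nth tnth_mktuple mxvecE. Qed.

Lemma msub_comp G H p : msub G (msub H p) = msub (\matrix_(a, b) msub G (H a b)) p.
Proof.
rewrite /msub subst_comp; congr (_ \mPo _); apply: eq_mktuple => k.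
by case/mxvec_indexP: k => a b; rewrite !mxvecE mxE.
Qed.

Lemma msub_id p : msub (\matrix_(a, b) 'X_(ix a b)) p = p.
Proof.
rewrite -[RHS]comp_mpoly_id; congr (_ \mPo _); apply: eq_mktuple => k.
by case/mxvec_indexP: k => a b; rewrite !mxvecE mxE.
Qed.

Definition row_shift (r r' : 'I_m) (s : K) (S : pred 'I_n) : 'M[{mpoly K[m * n]}]_(m, n) :=
  \matrix_(a, b) ('X_(ix a b) + (if (a == r) && S b then s else 0) *: 'X_(ix r' b)).

Lemma msupp_row_shift r r' s (S : pred 'I_n) a b v :
  v \in msupp (row_shift r r' s S a b) ->
  v = U_(ix a b)%MM \/ [/\ a = r, S b & v = U_(ix r' b)%MM].
Proof.
rewrite mxE; case: ifP => [/andP[/eqP ar Sb] /msupp_XDZX [] ->|_]; [by left | by right |].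
by rewrite scale0r addr0 msuppX inE => /eqP->; left.
Qed.

Definition tail_ge u a (c : 'I_n) := (\sum_(b < n | c <= b) u (ix a b))%N.
Definition tail_gt u a (c : 'I_n) := (\sum_(b < n | c < b) u (ix a b))%N.

Lemma tail_gtD u v a c : tail_gt (u + v)%MM a c = (tail_gt u a c + tail_gt v a c)%N.
Proof. by rewrite /tail_gt -big_split; apply: eq_bigr => b _; rewrite mnmDE. Qed.

Lemma tail_geD u v a c : tail_ge (u + v)%MM a c = (tail_ge u a c + tail_ge v a c)%N.
Proof. by rewrite /tail_ge -big_split; apply: eq_bigr => b _; rewrite mnmDE. Qed.

Lemma tail_gt0 a c : tail_gt 0%MM a c = 0%N.
Proof. by rewrite /tail_gt big1 // => b _; rewrite mnm0E. Qed.

Lemma tail_gtU a a' b c : tail_gt U_(ix a b)%MM a' c = (a == a') && (c < b)%N.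
Proof.
rewrite /tail_gt; have [cb|cb] := boolP (c < b)%N.
  rewrite (bigD1 b) //= mnm1E mxvec_index_eq eqxx andbT big1 ?addn0 // => d /andP[_ db].
  by rewrite mnm1E mxvec_index_eq [b == d]eq_sym (negbTE db) andbF.
rewrite andbF big1 // => d cd; rewrite mnm1E mxvec_index_eq.
by case: (eqVneq b d) cb => [->|]; rewrite ?cd ?andbF.
Qed.

Lemma tail_geE u a c : tail_ge u a c = (u (ix a c) + tail_gt u a c)%N.
Proof.
rewrite /tail_ge (bigD1 c) //=; congr (_ + _)%N; apply: eq_bigl => b.
by rewrite ltn_neqAle andbC eq_sym.
Qed.

Lemma row_sum_tail u a (c : 'I_n) :
  row_sum u a = (\sum_(b < n | b < c) u (ix a b) + tail_ge u a c)%N.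
Proof.
rewrite /row_sum (bigID (fun b : 'I_n => (b < c)%N)) /=; congr (_ + _)%N.
by apply: eq_bigl => b; rewrite -leqNgt.
Qed.

(** Columns are read from left to right and each column from top to bottom, which makes the main
    diagonal of a maximal minor its initial monomial. *)
Definition column_pos (k : 'I_(m * n)) : nat :=
  mxvec (\matrix_(a < m, b < n) (b * m + a)%N) ord0 k.

Lemma column_pos_ltc a a' (b b' : 'I_n) :
  (b < b')%N -> (column_pos (ix a b) < column_pos (ix a' b'))%N.
Proof.
move=> bb'; rewrite /column_pos !mxvecE !mxE.
apply: (@leq_trans (b.+1 * m)); first by rewrite mulSn addnC ltn_add2r.
by apply: leq_trans (leq_addr _ _); rewrite leq_mul2r bb' orbT.
Qed.

Lemma column_pos_ltr (a a' : 'I_m) b :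
  (column_pos (ix a b) < column_pos (ix a' b))%N = (a < a')%N.
Proof. by rewrite /column_pos !mxvecE !mxE ltn_add2l. Qed.

Lemma column_pos_inj : injective column_pos.
Proof.
move=> k l; case/mxvec_indexP: k => a b; case/mxvec_indexP: l => a' b' e.
have [lt|lt|/val_inj eb] := ltngtP b b'.
- by have := column_pos_ltc a a' lt; rewrite e ltnn.
- by have := column_pos_ltc a' a lt; rewrite e ltnn.
subst b'; have [lt|lt|/val_inj -> //] := ltngtP a a'.
  by have := column_pos_ltr a a' b; rewrite lt e ltnn.
by have := column_pos_ltr a' a b; rewrite lt e ltnn.
Qed.

Lemma lex_leU (pos : 'I_(m * n) -> nat) k l :
  (pos k < pos l)%N -> lex_le pos U_(l)%MM U_(k)%MM.
Proof.
move=> kl; apply/lex_leP; right; exists k => [|j jk].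
  by rewrite !mnm1E eqxx; case: eqVneq kl => // ->; rewrite ltnn.
rewrite !mnm1E; case: eqVneq => [e|_].
  by move: (ltn_trans jk kl); rewrite -e ltnn.
by case: eqVneq => [e|//]; move: jk; rewrite e ltnn.
Qed.

Lemma initial_monomial_XDZX le (s : K) k l : monomial_order le -> k != l -> s != 0 ->
  is_initial_monomial le ('X_k + s *: 'X_l : {mpoly K[m * n]})
    (if le U_(l)%MM U_(k)%MM then U_(k)%MM else U_(l)%MM).
Proof.
move=> le_mo kl s0; have tot : le U_(l)%MM U_(k)%MM || le U_(k)%MM U_(l)%MM.
  by case: le_mo => tot _ _ _ _; apply: tot.
split; first rewrite mcoeff_msupp mcoeffD mcoeffZ !mcoeffX.
  case: ifP => _; rewrite eqxx !eq_mnm1 ?[l == k]eq_sym (negbTE kl) /=.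
    by rewrite mulr0 addr0 oner_eq0.
  by rewrite mulr1 add0r.
move=> v /msupp_XDZX [] ->; case: ifP tot => //= le_lk _; exact: (mo_refl le_mo).
Qed.

(** * Comparison of two rows of an initial monomial *)

Section TwoRows.
Variables (i i' : 'I_m) (c : 'I_n).
Hypothesis ii' : (i < i')%N.

Let i_neq : i != i'.
Proof. by apply: contraTneq ii' => ->; rewrite ltnn. Qed.

(* Write x_b and y_b for the variables of column b in rows i and i'. Then sigma
   is x_b |-> x_b + y_b for b > c and tau is x_b |-> x_b - y_b for b <= c. *)
Let after : pred 'I_n := fun b => (c < b)%N.
Let upto : pred 'I_n := fun b => (b <= c)%N.

Let sigma := msub (row_shift i i' 1 after).
Let tau := msub (row_shift i i' (-1) upto).
Let rho := msub (row_shift i' i (-1) after).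

(** [tau] undoes the full row operation on the columns up to [c] and leaves it on the later ones.
    Hence [sigma f = tau f] when [f] is invariant. *)
Let tau_phi p : tau (msub (row_shift i i' 1 predT) p) = sigma p.
Proof.
rewrite /tau /sigma msub_comp; congr (msub _ p); apply/matrixP => a b; rewrite !mxE.
rewrite /msub linearD linearZ /= -!/(msub _ _) !msubX !mxE.
have [->|ai] := eqVneq a i; last by rewrite /= !scale0r !addr0.
rewrite [i' == i]eq_sym (negbTE i_neq) /= scale0r addr0 scale1r /upto /after ltnNge.
by case: (b <= c)%N; rewrite /= ?scale0r ?scaleN1r ?addr0 ?scale1r // addrNK.
Qed.

(* The unimodular substitution (x, y) |-> (y, y - x). *)
Let kappa := msub (\matrix_(a, b)
  if after b && (a == i) then 'X_(ix i' b) else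
  if after b && (a == i') then 'X_(ix i' b) + (-1) *: 'X_(ix i b) else 'X_(ix a b)).

Let kappa_inv := msub (\matrix_(a, b)
  if after b && (a == i) then 'X_(ix i b) + (-1) *: 'X_(ix i' b) else
  if after b && (a == i') then 'X_(ix i b) else 'X_(ix a b)).

Let kappaK p : kappa_inv (kappa p) = p.
Proof.
rewrite /kappa /kappa_inv msub_comp -[RHS]msub_id; congr (msub _ p).
apply/matrixP => a b; rewrite !mxE.
case ab: (after b) => /=; last by rewrite msubX !mxE ab.
have [->|ai] := eqVneq a i; first by rewrite msubX !mxE ab eq_sym (negbTE i_neq) eqxx.
have [->|ai'] := eqVneq a i'; last by rewrite msubX !mxE ab (negbTE ai) (negbTE ai').
rewrite /msub linearD linearZ /= -!/(msub _ _) !msubX !mxE ab eq_sym (negbTE i_neq) !eqxx /=.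
by rewrite !scaleN1r opprB addrC subrK.
Qed.

Let rho_sigma p : rho (sigma p) = kappa p.
Proof.
rewrite /rho /sigma /kappa msub_comp; congr (msub _ p); apply/matrixP => a b; rewrite !mxE.
rewrite /msub linearD linearZ /= -!/(msub _ _) !msubX !mxE.
case ab: (after b); rewrite /= ?andbT ?andbF ?scale0r ?addr0 //.
have [->|ai] := eqVneq a i.
  by rewrite (negbTE i_neq) eqxx !scale0r addr0 scale1r scaleN1r addrC subrK.
by rewrite !scale0r addr0; case: eqVneq => [->|]; rewrite ?scale0r ?addr0.
Qed.

(** Consider a monomial of [kappa h], which is nonzero since [kappa] is injective. Its x-degree
    after [c] comes only from variables y of [h], so it is at most [d]. It is at least [e] because
    [kappa h = rho (sigma h)] and [rho] never lowers that degree. *)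
Let sigma_degree h d e : h != 0 ->
    (forall v, v \in msupp h -> (tail_gt v i' c <= d)%N) ->
    (forall v, v \in msupp (sigma h) -> (e <= tail_gt v i c)%N) ->
  (e <= d)%N.
Proof.
move=> h0 hd he; have : kappa h != 0.
  by apply: contra_neq h0 => k0; rewrite -[h]kappaK k0 /kappa_inv /msub linear0.
rewrite -msupp_eq0; case E : (msupp (kappa h)) => [//|w s] _.
have wk : w \in msupp (kappa h) by rewrite E mem_head.
have [v vh] : exists2 v, v \in msupp h & (tail_gt w i c <= tail_gt v i' c)%N.
  move: wk; apply: (subst_supp (R := fun v w => (tail_gt w i c <= tail_gt v i' c)%N)).
  apply: msub_compatible => [|a a' b b'|a b v]; first by rewrite !tail_gt0.
    by rewrite !tail_gtD; apply: leq_add.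
  rewrite mxE tail_gtU; case ab: (after b) => /=; last first.
    by rewrite msuppX inE => /eqP->; rewrite tail_gtU [(c < b)%N]ab andbF.
  have [->|ai] := eqVneq a i.
    by rewrite msuppX inE => /eqP->; rewrite tail_gtU eq_sym (negbTE i_neq).
  have [_|ai'] := eqVneq a i'.
    by case/msupp_XDZX => ->; rewrite [(c < b)%N]ab tail_gtU; case: (_ && _).
  by rewrite msuppX inE => /eqP->; rewrite tail_gtU (negbTE ai).
move=> wv; apply: leq_trans (hd _ vh); apply: leq_trans wv.
move: wk; rewrite -rho_sigma => /(subst_supp (R := fun v w => (tail_gt v i c <= tail_gt w i c)%N)).
case=> [|x /he ex xw]; last exact: leq_trans ex xw.
apply: msub_compatible => [|a a' b b'|a b x]; first by rewrite !tail_gt0.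
  by rewrite !tail_gtD; apply: leq_add.
move=> /msupp_row_shift [->//|[-> cb ->]].
by rewrite !tail_gtU eqxx [(c < b)%N]cb; case: (_ && _).
Qed.

Section Facet.
Variables (f : {mpoly K[m * n]}) (u : 'X_{1..m * n}).
Hypothesis f_rows : forall v, v \in msupp f -> forall a a', row_sum v a = row_sum v a'.
Hypothesis f_shift : msub (row_shift i i' 1 predT) f = f.
Hypothesis f_init : is_initial_monomial (lex_le column_pos) f u.

Let in_rows (a : 'I_m) := (a == i) || (a == i').

(* The monomial u with x_c replaced by y_c; sigma f = tau f is compared on the
   monomials that agree with it outside the x_b, y_b with b > c. *)
Let v0 := (u - U_(ix i c) *+ u (ix i c) + U_(ix i' c) *+ u (ix i c))%MM.

Let v0E a b : v0 (ix a b) =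
  (u (ix a b) - ((i == a) && (c == b)) * u (ix i c) + ((i' == a) && (c == b)) * u (ix i c))%N.
Proof. by rewrite mnmDE mnmBE !mulmnE !mnm1E !mxvec_index_eq. Qed.

Let v0_xc : v0 (ix i c) = 0%N.
Proof. by rewrite v0E !eqxx [i' == i]eq_sym (negbTE i_neq) mul1n subnn. Qed.

Let v0_yc : v0 (ix i' c) = (u (ix i' c) + u (ix i c))%N.
Proof. by rewrite v0E !eqxx (negbTE i_neq) mul1n subn0. Qed.

Let v0_col a b : b != c -> v0 (ix a b) = u (ix a b).
Proof. by move=> bc; rewrite v0E [c == b]eq_sym (negbTE bc) !andbF subn0 addn0. Qed.

Let v0_row a b : ~~ in_rows a -> v0 (ix a b) = u (ix a b).
Proof.
rewrite negb_or => /andP[ai ai']; rewrite v0E [i == a]eq_sym [i' == a]eq_sym.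
by rewrite (negbTE ai) (negbTE ai') subn0 addn0.
Qed.

Let u_split : u = (u - U_(ix i c) *+ u (ix i c) + U_(ix i c) *+ u (ix i c))%MM.
Proof.
rewrite submK //; apply/mnm_lepP => k; rewrite mulmnE mnm1E.
by case: eqVneq => [<-|]; rewrite ?mul1n.
Qed.

Let mdeg_v0 : mdeg v0 = mdeg u.
Proof. by rewrite [in RHS]u_split !mdegD !mdegMn !mdeg1. Qed.

(** The condition on [mdeg] fixes all row sums of the monomials of [f] in [P], through
    [row_sum_deg]. *)
Let P : pred 'X_{1..m * n} := fun v => (mdeg v == mdeg u) &&
  [forall a, forall b, ~~ (after b && in_rows a) ==> (v (ix a b) == v0 (ix a b))].

Let PP v : reflect
  (mdeg v = mdeg u /\ forall a b, ~~ (after b && in_rows a) -> v (ix a b) = v0 (ix a b)) (P v).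
Proof.
apply: (iffP andP) => [[/eqP-> /forallP h]|[-> h]]; split=> //.
  by move=> a b ab; apply/eqP; apply: (implyP (forallP (h a) b)).
by apply/forallP => a; apply/forallP => b; apply/implyP => /h ->.
Qed.

Let P_v0 : P v0. Proof. exact/PP. Qed.

Let sigma_restrict p : mpoly_restrict P (sigma p) = sigma (mpoly_restrict P p).
Proof.
apply: (restrict_subst (R := fun v w => mdeg v = mdeg w /\
  forall a b, ~~ (after b && in_rows a) -> v (ix a b) = w (ix a b))).
  apply: msub_compatible => [//|v v' w w' [dv vv'] [dw ww']|a b v].
    by rewrite !mdegD dv dw; split=> // a b ab; rewrite !mnmDE vv' ?ww'.
  case/msupp_row_shift => [->//|[-> ab ->]]; rewrite !mdeg1; split=> // a' b'.
  rewrite !mnm1E !mxvec_index_eq negb_and negb_or => h.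
  have [eb|] := eqVneq b b'; last by rewrite !andbF.
  move: h; rewrite -eb ab /= => /andP[a'i a'i'].
  by rewrite ![_ == a']eq_sym (negbTE a'i) (negbTE a'i').
move=> v w [dvw vw]; apply/PP/PP => -[d h]; split=> [|a b ab].
- by rewrite -dvw.
- by rewrite -vw // h.
- by rewrite dvw.
by rewrite vw // h.
Qed.

(** Describes the monomials [w] of [tau 'X_[v]]: some factors x_b with [b <= c] have been turned
    into y_b. *)
Let tau_rel v w := [/\ mdeg v = mdeg w,
  forall a b, ~~ (upto b && in_rows a) -> v (ix a b) = w (ix a b),
  forall b, (w (ix i b) <= v (ix i b))%N
  & forall b, (v (ix i b) + v (ix i' b) = w (ix i b) + w (ix i' b))%N].

Let tau_compatible :
  subst_compatible (mxvec (row_shift i i' (-1) upto) ord0) tau_rel.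
Proof.
apply: msub_compatible => [|v v' w w' [dv ev lv sv] [dw ew lw sw]|a b v].
- by split.
- split=> [|a b ab|b|b]; rewrite ?mdegD ?mnmDE.
  + by rewrite dv dw.
  + by rewrite ev ?ew.
  + exact: leq_add.
  by rewrite addnACA sv sw addnACA.
case/msupp_row_shift => [->|[-> ub ->]]; first by split.
split=> [|a' b'|b'|b']; rewrite ?mdeg1 // !mnm1E !mxvec_index_eq.
- rewrite negb_and negb_or => h; have [eb|] := eqVneq b b'; last by rewrite !andbF.
  move: h; rewrite -eb ub /= => /andP[a'i a'i'].
  by rewrite ![_ == a']eq_sym (negbTE a'i) (negbTE a'i').
- by rewrite [i' == i]eq_sym (negbTE i_neq).
by rewrite [i' == i]eq_sym (negbTE i_neq) !eqxx addn0 add0n.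
Qed.

(** All rows of a monomial of [f] have the same sum, so its degree is [m] times that sum. *)
Let row_sum_deg v a : v \in msupp f -> mdeg v = mdeg u -> row_sum v a = row_sum u a.
Proof.
have md w : w \in msupp f -> mdeg w = (m * row_sum w a)%N.
  move=> wf; rewrite mdeg_row_sum (eq_bigr (fun=> row_sum w a)) => [|x _]; last exact: f_rows.
  by rewrite sum_nat_const card_ord.
move=> vf; rewrite !md //; last by case: f_init.
by move/eqP; rewrite eqn_pmul2l ?(leq_trans _ (ltn_ord i)) // => /eqP.
Qed.

(** As [u] is initial, [v] is smaller at their first difference, which lies in row [i] or [i'].
    Before column [c] this cannot happen: in row [i], [tau] never raises an x-exponent; in row [i'],
    the exponent of x_b already agrees and the sum for x_b and y_b is preserved. *)
Let tau_preimage v w : v \in msupp f -> tau_rel v w -> P w ->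
  [/\ forall a (b : 'I_n), (b < c)%N -> v (ix a b) = u (ix a b),
      (v (ix i c) <= u (ix i c))%N
    & row_sum v i = row_sum u i].
Proof.
move=> vf [dvw evw lvw svw] /PP [dw hw].
have rE a b : ~~ in_rows a -> v (ix a b) = u (ix a b).
  by move=> ra; rewrite evw ?(negbTE ra) ?andbF // hw ?(negbTE ra) ?andbF // v0_row.
have cE a (b : 'I_n) : (b < c)%N -> w (ix a b) = u (ix a b).
  move=> bc; rewrite hw; last by rewrite /after ltnNge (ltnW bc).
  by rewrite v0_col //; apply: contraTneq bc => ->; rewrite ltnn.
suff [eqc lec] : (forall a (b : 'I_n), (b < c)%N -> v (ix a b) = u (ix a b)) /\
    (v (ix i c) <= u (ix i c))%N.
  by split=> //; apply: row_sum_deg; rewrite ?dvw.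
have /lex_leP[->//|[k + hk]] := proj2 f_init v vf.
case/mxvec_indexP: k hk => a1 b1 hk vk.
have a1r : in_rows a1 by apply: contraLR vk => /rE->; rewrite ltnn.
have cb1 : (c <= b1)%N.
  rewrite leqNgt; apply/negP => b1c; have lt := lvw b1; rewrite cE // in lt.
  case/orP: a1r => /eqP a1E; subst a1; first by rewrite ltnNge lt in vk.
  have xE : v (ix i b1) = u (ix i b1) by apply: hk; rewrite column_pos_ltr.
  by have := svw b1; rewrite !cE // xE => /addnI e; rewrite e ltnn in vk.
split=> [a b bc|]; first by apply/hk/column_pos_ltc/(leq_trans bc cb1).
move: cb1; rewrite leq_eqVlt => /orP[/eqP/val_inj eb|cb1]; last by rewrite hk // column_pos_ltc.
subst b1; case/orP: a1r => /eqP a1E; subst a1; first exact: ltnW.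
by rewrite hk // column_pos_ltr.
Qed.

(** The sum of row [i] and its part before [c] are the same for [v] and [u], and [tau] does not
    touch the columns after [c]. *)
Let tau_degree v w : v \in msupp f -> tau_rel v w -> P w ->
  (v (ix i c) + tail_gt w i c = u (ix i c) + tail_gt u i c)%N.
Proof.
move=> vf vw Pw; have [eqc _ /eqP] := tau_preimage vf vw Pw.
rewrite !(row_sum_tail _ _ c) !tail_geE (eq_bigr (fun b => u (ix i b))) => [|b bc]; last exact: eqc.
rewrite eqn_add2l => /eqP <-; congr (_ + _)%N; apply: eq_bigr => b cb.
by case: vw => _ evw _ _; rewrite evw // /upto leqNgt cb.
Qed.

(* In the lexicographic order with y_c first, v0 is the initial monomial of
   tau applied to the monomial u. *)
Let tau_u_v0 : (tau 'X_[u])@_v0 != 0.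
Proof.
pose pos k := if k == ix i' c then 0%N else (column_pos k).+1.
have pos_inj : injective pos.
  by move=> k l; rewrite /pos; do 2!case: eqP => [->|_] //; case=> /column_pos_inj.
have mo := lex_le_mo pos_inj.
have mo_col := lex_le_mo column_pos_inj.
(* The initial monomials of the images of the variables: y_c now wins in x_c - y_c, while x_b still
   wins in x_b - y_b for [b < c] because [i < i']. *)
pose e k := mxvec (\matrix_(a, b)
  if (a == i) && (b == c) then U_(ix i' c)%MM else U_(ix a b)%MM) ord0 k.
have init k : is_initial_monomial (lex_le pos)
    (tnth [tuple mxvec (row_shift i i' (-1) upto) ord0 k | k < m * n] k) (e k).
  rewrite tnth_mktuple /e; case/mxvec_indexP: k => a b; rewrite !mxvecE !mxE.
  have [->|ai] := eqVneq a i; last by rewrite /= scale0r addr0; apply: initial_monomialX.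
  rewrite /upto /= leq_eqVlt; have [->|bc] := eqVneq b c.
    rewrite eqxx /=; have := @initial_monomial_XDZX (lex_le pos) (-1) (ix i c) (ix i' c) mo.
    rewrite mxvec_index_eq (negbTE i_neq) oppr_eq0 oner_eq0 /= => /(_ isT isT).
    case: ifP => // le1; have : lex_le pos U_(ix i c)%MM U_(ix i' c)%MM.
      by apply: lex_leU; rewrite /pos eqxx mxvec_index_eq (negbTE i_neq).
    case: mo => _ asym _ _ _ le2.
    have /eqP : U_(ix i c)%MM = U_(ix i' c)%MM by apply: asym; rewrite le1 le2.
    by rewrite eq_mnm1 mxvec_index_eq (negbTE i_neq).
  rewrite (inj_eq val_inj) (negbTE bc) /=; case: ifP => [lt|_]; last first.
    by rewrite scale0r addr0; apply: initial_monomialX.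
  have := @initial_monomial_XDZX (lex_le pos) (-1) (ix i b) (ix i' b) mo.
  rewrite mxvec_index_eq (negbTE i_neq) oppr_eq0 oner_eq0 /= => /(_ isT isT).
  rewrite lex_leU // /pos !mxvec_index_eq (negbTE bc) !andbF ltnS column_pos_ltr //.
have -> : v0 = (\sum_k e k *+ u k)%MM.
  have uE : u = (\sum_(k | k != ix i c) U_(k) *+ u k + U_(ix i c) *+ u (ix i c))%MM.
    by rewrite {1}(multinomUE_id u) (bigD1 (ix i c)) //= addmC.
  rewrite /v0 {1}uE addmK [RHS](bigD1 (ix i c)) //= addmC; congr (_ + _)%MM.
    by rewrite /e mxvecE mxE !eqxx.
  apply: eq_bigr => k; rewrite /e; case/mxvec_indexP: k => a b.
  by rewrite mxvecE mxE mxvec_index_eq => /negbTE->.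
rewrite -mcoeff_msupp /tau /msub comp_mpolyX.
by case: (@initial_monomial_prod K _ _ mo _ (index_enum _) _ e (fun k => u k) (fun k _ => init k)).
Qed.

(** Only [u] contributes to the coefficient at [v0]. Any other contributor agrees with [u] before
    [c] by [tau_preimage], after [c] since [tau] acts trivially there, and in column [c] by the
    degree count, so it equals [u]. *)
Let v0_supp : v0 \in msupp (mpoly_restrict P (tau f)).
Proof.
rewrite msupp_restrict P_v0 mcoeff_msupp /tau /msub comp_mpolyEX raddf_sum /=.
have uf : u \in msupp f by case: f_init.
rewrite (bigD1_seq u) ?msupp_uniq //= big_seq_cond big1 ?addr0.
  by rewrite mcoeffZ mulf_neq0 // -?mcoeff_msupp //; apply: tau_u_v0.
move=> v /andP[vf vu]; rewrite mcoeffZ [X in _ * X]memN_msupp_eq0 ?mulr0 //.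
apply/negP => /(subst_supp tau_compatible) [_ /mem_msuppXP <- vv0].
have [eqc lec rs] := tau_preimage vf vv0 P_v0.
have t0 : tail_gt v0 i c = tail_gt u i c.
  by apply: eq_bigr => b cb; rewrite v0_col //; apply: contraTneq cb => ->; rewrite ltnn.
have := tau_degree vf vv0 P_v0; rewrite t0 => /addIn xE.
case: vv0 => _ evw _ svw; case/eqP: vu; apply/mnm_matrixP => a b.
have [bc|cb|/val_inj ->] := ltngtP b c; first exact: eqc.
  rewrite evw /upto ?[(b <= c)%N]leqNgt ?cb // v0_col //.
  by apply: contraTneq cb => ->; rewrite ltnn.
have [/orP[/eqP->//|/eqP->]|ra] := boolP (in_rows a).
  by have := svw c; rewrite v0_xc v0_yc xE add0n addnC => /addIn.
by rewrite evw ?(negbTE ra) ?andbF // v0_row.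
Qed.

(** Let [h] be the part of [f] on [P]. Its monomials have degree [tail_gt u i' c - u (ix i c)] in
    the y_b after [c], because in [v0] the power of x_c has moved to y_c. Those of [sigma h], the
    part of [tau f] on [P], have degree at least [tail_gt u i c] in the x_b after [c]. Then
    [sigma_degree] compares the two. *)
Lemma facet_inequality : (tail_ge u i c <= tail_gt u i' c)%N.
Proof.
have fE : sigma f = tau f by rewrite -tau_phi f_shift.
pose h := mpoly_restrict P f; have hE : sigma h = mpoly_restrict P (tau f).
  by rewrite -sigma_restrict fE.
have h0 : h != 0.
  apply/eqP => h0; have := v0_supp; rewrite -hE h0 /sigma /msub linear0.
  by rewrite -mpolyC0 msupp0.
have degy v : v \in msupp h -> (tail_gt v i' c + u (ix i c) = tail_gt u i' c)%N.
  rewrite msupp_restrict => /andP[/PP [dv hv] vf].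
  have /eqP := row_sum_deg i' vf dv; rewrite !(row_sum_tail _ _ c) !tail_geE.
  rewrite hv ?/after ?ltnn // v0_yc (eq_bigr (fun b => u (ix i' b))) => [|b bc].
    by rewrite eqn_add2l -addnA eqn_add2l addnC => /eqP.
  rewrite hv ?/after 1?ltnNge ?(ltnW bc) // v0_col //.
  by apply: contraTneq bc => ->; rewrite ltnn.
have [v vh] : exists v, v \in msupp h.
  by move: h0; rewrite -msupp_eq0; case: (msupp h) => // v s _; exists v; rewrite mem_head.
rewrite tail_geE -(degy v vh) addnC leq_add2r.
apply: (sigma_degree h0) => [w /degy wE|w].
  by rewrite -(leq_add2r (u (ix i c))) wE (degy v vh).
rewrite hE msupp_restrict => /andP[Pw /(subst_supp tau_compatible) [x xf xw]].
have [_ lec _] := tau_preimage xf xw Pw.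
by rewrite -(leq_add2l (u (ix i c))) -(tau_degree xf xw Pw) leq_add2r.
Qed.

End Facet.

End TwoRows.
End MatrixSubstitution.

(** * Maximal minors *)

Section MaximalMinors.
Variables (K : fieldType) (m n : nat).
Local Notation ix := (@mxvec_index m n).
Local Notation X := (generic_matrix K m n).
Implicit Types (u v : 'X_{1..m * n}).
Local Notation le := (@lex_le (m * n) (@column_pos m n)).

Lemma msub_minor k (f : 'I_k -> 'I_m) (g : 'I_k -> 'I_n) H :
  msub H (minor K f g) = \det (mxsub f g H).
Proof.
rewrite /msub /minor -det_map_mx; congr (\det _); apply/matrixP => a b.
by rewrite !mxE; apply: msubX.
Qed.

(** By linearity in the modified row, the additional term is the determinant of a matrix with two
    equal rows. *)
Lemma row_shift_minor (f : 'I_m -> 'I_m) (g : 'I_m -> 'I_n) i i' : i != i' -> injective f ->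
  msub (row_shift i i' 1 predT) (minor K f g) = minor K f g.
Proof.
move=> ii' fi; rewrite msub_minor /minor.
pose s0 := invF fi i; pose s1 := invF fi i'; set M := mxsub f g X.
have fs0 : f s0 = i by rewrite f_invF.
have fs1 : f s1 = i' by rewrite f_invF.
have s01 : s0 != s1 by apply: contraNneq ii' => e; rewrite -fs0 e fs1.
pose C := \matrix_(a, b) (if a == s0 then M s1 b else M a b).
have C0 : \det C = 0.
  by apply: (determinant_alternate s01) => b; rewrite !mxE eqxx eq_sym (negbTE s01).
rewrite -[RHS]addr0 -C0 -[\det M]mul1r -[\det C]mul1r.
apply: (@determinant_multilinear _ _ _ _ _ s0).
- by apply/rowP => b; rewrite !mxE fs0 fs1 !eqxx scale1r !mul1r.
- apply/matrixP => a b; rewrite !mxE -fs0 (inj_eq fi) eq_sym (negbTE (neq_lift _ _)).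
  by rewrite scale0r addr0.
apply/matrixP => a b; rewrite !mxE -fs0 (inj_eq fi) eq_sym (negbTE (neq_lift _ _)).
by rewrite scale0r addr0.
Qed.

(** The two properties together define a subalgebra, so they need only be checked on the maximal
    minors, which involve every row. *)
Lemma maximal_minors_invariant p : @minors_algebra K m n m p ->
  (forall v, v \in msupp p -> forall a a', row_sum v a = row_sum v a') /\
  (forall i i' : 'I_m, i != i' -> msub (row_shift i i' 1 predT) p = p).
Proof.
move=> Ap; pose B (p : {mpoly K[m * n]}) :=
  (forall v, v \in msupp p -> forall a a', row_sum v a = row_sum v a') /\
  (forall i i' : 'I_m, i != i' -> msub (row_shift i i' 1 predT) p = p).
apply: (Ap B) => {p Ap} [|_ [f [g [/increasing_inj fi _ ->]]]]; last first.
  split=> [v vs a a'|i i' ii']; last exact: row_shift_minor.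
  have fE x : x \in codom f by rewrite -(f_invF fi x) codom_f.
  by rewrite !(row_sum_minor _ fi vs) !fE.
split.
- split=> [v|i i' _]; last by rewrite /msub comp_mpoly1.
  by rewrite -mpolyC1 msupp1 inE => /eqP-> a a'; rewrite !row_sum0.
- move=> c p q [pr ps] [qr qs]; split=> [v|i i' ii'].
    move=> /msuppD_le; rewrite mem_cat => /orP[/msuppZ_le|]; [exact: pr | exact: qr].
  by rewrite /msub linearP /= -!/(msub _ _) ps ?qs.
move=> p q [pr ps] [qr qs]; split=> [v|i i' ii'].
  move=> /msuppM_le /allpairsP[[x y] /= [/pr xr /qr yr ->]] a a'.
  by rewrite !row_sumD (xr a a') (yr a a').
by rewrite /msub rmorphM /= -!/(msub _ _) ps ?qs.
Qed.

(** If [v] is larger at a first difference [(a, g b)], then [b != a]. For [a < b] the earlier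
    position [(a, g a)] must be in [v], giving row [a] two entries; for [b < a] the earlier position
    [(b, g b)] gives column [g b] two entries. *)
Lemma initial_maximal_minor (g : 'I_m -> 'I_n) : increasing g ->
  is_initial_monomial le (minor K id g) (matching_mnm id g 1%g).
Proof.
move=> gi; have g_inj := increasing_inj gi.
have idi : injective (@id 'I_m) by [].
split=> [|v vs]; first exact: matching_mnm_supp.
have dE a b : matching_mnm id g 1%g (ix a b) = (g a == b) :> nat.
  by rewrite (matching_mnmE g 1%g a b idi) perm1.
have rv a : row_sum v a = 1%N.
  by rewrite (row_sum_minor a idi vs) -[a]/(id a) codom_f.
have cv b : col_sum v b = (b \in codom g) by rewrite (col_sum_minor b g_inj vs).
apply/lex_leP; have [->|/(first_difference (@column_pos m n)) [k + hk]] :=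
  eqVneq v (matching_mnm id g 1%g); first by left.
case/mxvec_indexP: k hk => a c hk vk; right; exists (ix a c) => //.
case: ltngtP vk => //; rewrite dE => vk _.
have vac : (0 < v (ix a c))%N by apply: leq_ltn_trans vk.
have : (0 < col_sum v c)%N by apply: leq_trans vac (leq_col_sum _ _ _).
rewrite cv; case: (boolP (c \in _)) => // /codomP [b cb] _; subst c.
have ba : b != a.
  apply: contraTneq vk => ba; rewrite ba eqxx -leqNgt.
  by rewrite -[nat_of_bool true]/1%N -(rv a); apply: leq_row_sum.
have vb0 : v (ix b (g b)) = 0%N.
  have := cv (g b); rewrite codom_f /col_sum (bigD1 a) //= (bigD1 b) //= .
  case: (v (ix a _)) vac => // ? _; rewrite addSn => -[] /eqP.
  by rewrite !addn_eq0 => /and3P[_ /eqP].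
have va0 : v (ix a (g a)) = 0%N.
  have gab : g a != g b by rewrite (inj_eq g_inj) eq_sym.
  have := rv a; rewrite /row_sum (bigD1 (g b)) //= (bigD1 (g a)) //= .
  case: (v (ix a (g b))) vac => // ? _; rewrite addSn => -[] /eqP.
  by rewrite !addn_eq0 => /and3P[_ /eqP].
have [ab|ba'|/val_inj e] := ltngtP a b; last by rewrite e eqxx in ba.
  by have := hk _ (column_pos_ltc a a (gi _ _ ab)); rewrite dE eqxx va0.
have : (column_pos (ix b (g b)) < column_pos (ix a (g b)))%N by rewrite column_pos_ltr.
by move=> /hk; rewrite dE eqxx vb0.
Qed.

(* The leftmost entries of the rows form a diagonal that can be split off. *)
Lemma diagonal_decomposition d u :
    (forall a, row_sum u a = d) ->
    (forall (a a' : 'I_m) c, (a < a')%N -> (tail_ge u a c <= tail_gt u a' c)%N) ->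
  monoid_gen (initial_exponents le (@minors K m n m)) u.
Proof.
elim: d u => [|d IHd] u ur uf.
  have -> : u = 0%MM.
    by apply/eqP; rewrite -mdeg_eq0 mdeg_row_sum big1.
  exact: monoid_gen0.
have ex a : exists b, (0 < u (ix a b))%N.
  apply/existsP; rewrite -[[exists _, _]]negbK negb_exists; apply/negP => /forallP u0.
  have := ur a; rewrite /row_sum big1 // => j _.
  by apply/eqP; rewrite -leqn0 leqNgt u0.
pose g a : 'I_n := [arg min_(b < xchoose (ex a) | (0 < u (ix a b))%N) b].
have g_pos a : (0 < u (ix a (g a)))%N.
  by rewrite /g; case: arg_minnP => //; exact: (xchooseP (ex a)).
have g_min a (b : 'I_n) : (b < g a)%N -> u (ix a b) = 0%N.
  rewrite /g; case: arg_minnP => [|x _ xmin]; first exact: (xchooseP (ex a)).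
  by move=> bx; apply/eqP; rewrite -leqn0 leqNgt; apply: contraTN bx => /xmin; rewrite -leqNgt.
(* Otherwise row [a] has all its [d.+1] factors from column [g a] on, while row [a'] has one at or
   before that column, contradicting the inequality at [g a]. *)
have g_incr : increasing g.
  move=> a a' aa'; rewrite ltnNge; apply/negP => ga.
  have := uf a a' (g a) aa'.
  have -> : tail_ge u a (g a) = d.+1.
    by rewrite -(ur a) (row_sum_tail _ _ (g a)) big1 // => b; apply: g_min.
  apply/negP; rewrite -ltnNge -(ur a') (row_sum_tail _ _ (g a)) tail_geE.
  have [e|ne] := eqVneq (g a') (g a).
    by rewrite -e addnA -[X in (X < _)%N]add0n ltn_add2r addn_gt0 g_pos orbT.
  have lt : (g a' < g a)%N by rewrite ltn_neqAle ga andbT (inj_eq val_inj).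
  rewrite (bigD1 (g a')) //= -!addnA -[X in (X < _)%N]add0n addnA addnA.
  by rewrite ltn_add2r -!addnA addn_gt0 g_pos.
pose D := matching_mnm (@id 'I_m) g 1%g.
have dE a b : D (ix a b) = (g a == b) :> nat.
  by rewrite (matching_mnmE g 1%g a b (@inj_id _)) perm1.
have Du : (D <= u)%MM.
  apply/mnm_lepP => k; case/mxvec_indexP: k => a b; rewrite dE.
  by case: eqVneq => // <-; apply: g_pos.
have uE : u = (u - D + D)%MM by rewrite submK.
have Dr a : row_sum D a = 1%N.
  rewrite /row_sum (bigD1 (g a)) //= dE eqxx big1 // => b.
  by rewrite dE eq_sym => /negbTE->.
have Dge a c : tail_ge D a c = (c <= g a)%N.
  rewrite /tail_ge; have [cg|cg] := boolP (c <= g a)%N.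
    rewrite (bigD1 (g a)) //= dE eqxx big1 // => b /andP[_].
    by rewrite dE eq_sym => /negbTE->.
  by rewrite big1 // => b cb; rewrite dE; case: eqVneq cb => // <-; rewrite (negbTE cg).
have Dgt a c : tail_gt D a c = (c < g a)%N.
  by have := Dge a c; rewrite tail_geE dE leq_eqVlt (inj_eq val_inj) [c == _]eq_sym;
    case: eqVneq => [->|_] //=; rewrite ltnn add1n => -[].
rewrite uE; apply: monoid_genD; last first.
  apply: monoid_gen1; exists (minor K id g); last exact: initial_maximal_minor.
  by exists id, g; split.
have ur' a : row_sum (u - D)%MM a = d.
  by have := ur a; rewrite {1}uE row_sumD Dr addn1 => -[].
apply: IHd => // a a' c aa'.
have := uf a a' c aa'; rewrite {1 2}uE tail_geD tail_gtD Dge Dgt.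
(* If [c <= g a], both sides drop by one. If [g a < c], the left side is unchanged; the right side
   drops only when [c < g a'], and it then equals the whole row sum [d]. *)
have [cg|gc] := leqP c (g a).
  by rewrite (leq_ltn_trans cg (g_incr _ _ aa')) leq_add2r.
rewrite addn0; case: ltnP => [cg' _|_]; last by rewrite addn0.
have -> : tail_gt (u - D)%MM a' c = d.
  rewrite -(ur' a') (row_sum_tail _ _ c) tail_geE mnmBE g_min // sub0n add0n.
  by rewrite big1 // => b bc; rewrite mnmBE g_min // (ltn_trans bc cg').
by rewrite -(ur' a) (row_sum_tail _ _ c) leq_addl.
Qed.

Lemma maximal_minors_sagbi : (0 < m)%N ->
  exists le : rel 'X_{1..m * n},
    monomial_order le /\ sagbi_basis le (@minors K m n m) (@minors_algebra K m n m).
Proof.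
move=> m0; have mo : monomial_order le by apply/lex_le_mo/column_pos_inj.
exists le; split=> //; apply: sagbi_basis_intro => // [|f|f u Af fu].
- exact: generated_subalgebraP.
- exact: generated_subalgebra_gen.
have [f_rows f_shift] := maximal_minors_invariant Af.
apply: (@diagonal_decomposition (row_sum u (Ordinal m0))) => [a|a a' c aa'].
  by apply: f_rows; case: fu.
have ne : a != a' by apply: contraTneq aa' => ->; rewrite ltnn.
exact: (facet_inequality c aa' f_rows (f_shift _ _ ne) fu).
Qed.

End MaximalMinors.

(** * Assembling the equivalence *)

Lemma exists_set_card k l : (k <= l)%N -> exists A : {set 'I_l}, #|A| = k.
Proof.
move=> kl; exists [set widen_ord kl x | x : 'I_k].
by rewrite card_imset ?card_ord // => x y /(congr1 val) /= /val_inj.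
Qed.

Local Close Scope ring_scope.

Theorem theorem7p1 (K : fieldType) (m n t : nat)
    (hm : 0 < m) (hmn : m <= n) (ht : 1 <= t) (htm : t <= m) :
  (exists le : rel 'X_{1..m * n},
     monomial_order le /\
     sagbi_basis le (@minors K m n t) (@minors_algebra K m n t))
  <->
  (m = t /\ t <= n) \/ (m = n /\ n = t + 1) \/ t = 1.
Proof.
split=> [[le [le_mo sagbi]]|[[<- _]|[[<- mt]|->]]].
- have [mt|tm] := leqP m t; first by left; split; lia.
  have [t1|t1] := leqP t 1; first by right; right; lia.
  have [nt|tn] := leqP n t.+1; first by right; left; lia.
  (* What remains is [t = p.+1] with [p > 0], at least [t + 1] rows and at least [t + 2] columns. *)
  case: t t1 sagbi tm tn {ht htm} => // p p0 sagbi tm tn.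
  have [R Rp] := exists_set_card tm; have [D Dp] := exists_set_card tn.
  by case: (minors_not_sagbi le_mo sagbi p0 Rp Dp).
- exact: maximal_minors_sagbi.
- subst m; rewrite addn1; exact: submaximal_sagbi.
exact: variables_sagbi.
Qed.
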